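(* Let $f(\mathbf z)=\sum_{\nu}c_\nu\mathbf z^\nu$ be a convergent power series in $\mathbf z=(z_1,\dots,z_n)$ with $f(\mathbf 0)=0$ which is non-degenerate and convenient, and let $B:=\max\{b_1,\dots,b_n\}$, where $\Gamma(f)$ meets the $\nu_j$-axis at the point $b_je_j$. Then the Łojasiewicz exponent satisfies $\ell_0(f)\le B-1$. Furthermore, if some Łojasiewicz monomial $z_i^{B}$ of $f$ is not Łojasiewicz exceptional, then $\ell_0(f)=B-1$.
   Context: The Newton diagram $\Gamma_+(f)$ is the convex hull of $\bigcup_{c_\nu\neq 0}(\nu+\mathbb R_{\ge 0}^n)$ and the Newton boundary $\Gamma(f)$ is the union of the compact faces of $\Gamma_+(f)$. For a weight vector $P=(p_1,\dots,p_n)\in\mathbb R_{\ge0}^n$, let $d(P,f)=\min\{\sum_ip_i\nu_i:\nu\in\Gamma_+(f)\}$, $\Delta(P,f)$ the face of $\Gamma_+(f)$ on which this minimum is attained, and $f_P=\sum_{\nu\in\Delta(P,f)}c_\nu\mathbf z^\nu$ the face function. $P$ is strictly positive if all $p_i>0$. $f$ is non-degenerate if for every strictly positive $P$ the polynomial $f_P$ has no critical point in $(\mathbb C^* )^n$. $f$ is convenient if for every $j=1,\dots,n$ the Newton boundary $\Gamma(f)$ meets the $\nu_j$-axis, at a point $b_je_j$ ($e_j$ the $j$-th standard basis vector). A Łojasiewicz monomial is a monomial $z_i^{B}$ with $b_i=B$. A Łojasiewicz monomial $z_i^B$ is Łojasiewicz exceptional if there exist $j\neq i$ and an integer $B'<B-1$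 such that the monomial $z_jz_i^{B'}$ has a non-zero coefficient in $f$. With $\partial f=(\partial f/\partial z_1,\dots,\partial f/\partial z_n)$, the Łojasiewicz exponent $\ell_0(f)$ is the infimum of the numbers $\theta>0$ for which there are $c>0$ and a neighbourhood $U$ of $\mathbf 0$ with $\|\partial f(\mathbf z)\|\ge c\|\mathbf z\|^\theta$ for all $\mathbf z\in U$. *)

(* Defs.v *)
From HB Require Import structures.
From mathcomp Require Import all_boot all_order all_algebra.
From mathcomp Require Import all_classical all_reals all_analysis.
From mathcomp Require Import complex.

Set Implicit Arguments.
Unset Strict Implicit.
Unset Printing Implicit Defensive.
Import Order.TTheory GRing.Theory Num.Theory.
Local Open Scope classical_set_scope.
Local Open Scope ring_scope.

Section Defs.
Variables (R : realType) (n : nat).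

Definition mindex := {ffun 'I_n -> nat}.
Definition powser := mindex -> R[i].
Definition cvec := 'I_n -> R[i].

Definition cabs2 (z : R[i]) : R := (@complex.Re R z) ^+ 2 + (@complex.Im R z) ^+ 2.
Definition cabs (z : R[i]) : R := Num.sqrt (cabs2 z).
Definition vnorm (z : cvec) : R := Num.sqrt (\sum_i cabs2 (z i)).

Definition ps_monom (nu : mindex) (z : cvec) : R[i] := \prod_i (z i) ^+ (nu i).
Definition unitidx (j : 'I_n) : mindex := [ffun i => (i == j : nat)].
Definition addidx (a b : mindex) : mindex := [ffun i => a i + b i].

Definition box_sum (F : mindex -> R[i]) (N : nat) : R[i] :=
  \sum_(m : {ffun 'I_n -> 'I_N}) F [ffun i => nat_of_ord (m i)].
Definition box_sumR (F : mindex -> R) (N : nat) : R :=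
  \sum_(m : {ffun 'I_n -> 'I_N}) F [ffun i => nat_of_ord (m i)].

Definition ps_has_sum (c : powser) (z : cvec) (w : R[i]) : Prop :=
  forall e : R, 0 < e -> exists N0 : nat, forall N : nat, (N0 <= N)%N ->
    cabs (box_sum (fun nu => c nu * ps_monom nu z) N - w) < e.

Definition ps_convergent (c : powser) : Prop :=
  exists r : R, 0 < r /\ forall z : cvec, vnorm z < r ->
    exists M : R, forall N : nat,
      box_sumR (fun nu => cabs (c nu) * cabs (ps_monom nu z)) N <= M.

Definition dcoef (j : 'I_n) (c : powser) : powser :=
  fun nu => (nu j).+1%:R * c (addidx nu (unitidx j)).

Definition rvec (nu : mindex) : 'rV[R^o]_n := \row_i ((nu i)%:R : R).
Definition dotR (P x : 'rV[R^o]_n) : R := \sum_i P 0 i * x 0 i.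
Definition ps_support (c : powser) : set mindex := [set nu | c nu != 0].

Definition Gamma_plus (c : powser) : set 'rV[R^o]_n :=
  [set x | exists (s : seq mindex) (lam : mindex -> R),
      [/\ {subset s <= ps_support c}, (forall nu, 0 <= lam nu),
          \sum_(nu <- s) lam nu = 1 &
          forall i, \sum_(nu <- s) lam nu * (nu i)%:R <= x 0 i]].

Definition dP (P : 'rV[R^o]_n) (c : powser) : R :=
  inf [set dotR P x | x in Gamma_plus c].

Definition DeltaP (P : 'rV[R^o]_n) (c : powser) : set 'rV[R^o]_n :=
  [set x | Gamma_plus c x /\ dotR P x = dP P c].

Definition nonneg_w (P : 'rV[R^o]_n) := forall i, 0 <= P 0 i.
Definition strictpos_w (P : 'rV[R^o]_n) := forall i, 0 < P 0 i.

Definition face_fun (P : 'rV[R^o]_n) (c : powser) : powser :=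
  fun nu => if `[< DeltaP P c (rvec nu) >] then c nu else 0.

Definition non_degenerate (c : powser) : Prop :=
  forall P : 'rV[R^o]_n, strictpos_w P ->
    ~ exists z : cvec, (forall i, z i != 0) /\
        forall j, ps_has_sum (dcoef j (face_fun P c)) z 0.

Definition Newton_boundary (c : powser) : set 'rV[R^o]_n :=
  [set x | exists P : 'rV[R^o]_n, [/\ nonneg_w P, compact (DeltaP P c) & DeltaP P c x]].

Definition axis_pt (j : 'I_n) (b : R) : 'rV[R^o]_n := \row_i (if i == j then b else 0).

Definition convenient (c : powser) : Prop :=
  forall j, exists b : R, Newton_boundary c (axis_pt j b).

Definition Lojasiewicz_exceptional (c : powser) (i : 'I_n) (B : R) : Prop :=
  exists (j : 'I_n) (B' : nat), j != i /\ (B'%:R < B - 1) /\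
    c (addidx (unitidx j) [ffun k => if k == i then B' else 0%N]) != 0.

Definition Loj_set (c : powser) : set R :=
  [set theta | 0 < theta /\ exists C eps : R, [/\ 0 < C, 0 < eps &
     forall z : cvec, vnorm z < eps -> forall w : cvec,
       (forall j, ps_has_sum (dcoef j c) z (w j)) ->
       C * (vnorm z) `^ theta <= vnorm w]].

Definition Loj_exponent (c : powser) : \bar R :=
  ereal_inf [set (theta%:E) | theta in Loj_set c].

End Defs.

(* Main.v *)
(* The idea is to work with all directions at once instead of along a curve.
   Let V be the finite set of exponents of f lying in a box large enough to
   contain all the b_j e_j, and let M(z) be the largest modulus |z^nu|, nu in V.
   The core estimate is  sum_j |z_j df/dz_j (z)| >= e M(z)  near the origin.
   Since M(z) >= |z_i|^{b_i}, taking i with |z_i| maximal and dividing by |z_i|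
   gives the exponent B - 1.

   If the estimate failed for every e, pick a maximal set S of monomials which stay
   comparable to M along points violating it.  The logarithms of the monomials of
   S differ boundedly, so a bounded correction of (-log|z_i|)_i is a strictly
   positive weight P whose face is exactly S, and z is obtained from a point a of
   a fixed compact part of the torus by the one-parameter group of weight P.
   Non-degeneracy and compactness bound the gradient of f_P at a from below,
   while the monomials outside S are negligible: a contradiction.

   For the equality, on the curve t e_i the gradient is O(t^{B-1}) because a
   monomial z_j z_i^{B'} with B' < B - 1 is absent. *)
Require Import Defs.
From HB Require Import structures.
From mathcomp Require Import all_boot all_order all_algebra.
From mathcomp Require Import all_classical all_reals all_analysis.
From mathcomp Require Import complex.
From mathcomp Require Import ring lra zify.
Import Order.TTheory GRing.Theory Num.Theory.
Local Open Scope classical_set_scope.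
Local Open Scope ring_scope.

Set Implicit Arguments.
Unset Strict Implicit.
Unset Printing Implicit Defensive.
Import numFieldNormedType.Exports.

(** * Complex modulus and multi-indices *)

Section ComplexModulus.
Variable R : realType.
Implicit Types x y z : R[i].

Lemma cabsE z : cabs z = Normc.normc z.
Proof. by case: z. Qed.

Lemma cabs_ge0 z : 0 <= cabs z.
Proof. exact: sqrtr_ge0. Qed.

Lemma cabs0 : cabs (0 : R[i]) = 0.
Proof. by rewrite cabsE Normc.normc0. Qed.

Lemma cabs1 : cabs (1 : R[i]) = 1.
Proof. by rewrite cabsE Normc.normc1. Qed.

Lemma cabsM x y : cabs (x * y) = cabs x * cabs y.
Proof. by rewrite !cabsE Normc.normcM. Qed.

Lemma ler_cabsD x y : cabs (x + y) <= cabs x + cabs y.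
Proof. by rewrite !cabsE; exact: le_normcD. Qed.

Lemma cabsN x : cabs (- x) = cabs x.
Proof. by rewrite !cabsE normcN. Qed.

Lemma cabs_eq0 x : (cabs x == 0) = (x == 0).
Proof.
apply/eqP/eqP => [|->]; last exact: cabs0.
by rewrite cabsE => /Normc.eq0_normc.
Qed.

Lemma cabs_gt0 x : (0 < cabs x) = (x != 0).
Proof. by rewrite lt_def cabs_ge0 andbT cabs_eq0. Qed.

Lemma cabsX x k : cabs (x ^+ k) = cabs x ^+ k.
Proof. by elim: k => [|k IH]; rewrite ?expr0 ?cabs1 // !exprS cabsM IH. Qed.

Lemma cabs_prod (I : Type) (s : seq I) (P : pred I) (F : I -> R[i]) :
  cabs (\prod_(i <- s | P i) F i) = \prod_(i <- s | P i) cabs (F i).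
Proof. exact: (big_morph _ cabsM cabs1). Qed.

Lemma ler_cabs_sum (I : Type) (s : seq I) (P : pred I) (F : I -> R[i]) :
  cabs (\sum_(i <- s | P i) F i) <= \sum_(i <- s | P i) cabs (F i).
Proof.
elim/big_rec2: _ => [|i x y _ h]; first by rewrite cabs0.
by apply: (le_trans (ler_cabsD _ _)); rewrite lerD2l.
Qed.

Lemma cabs_real (t : R) : cabs t%:C%C = `|t|.
Proof. by rewrite /cabs /cabs2 /= expr0n addr0 sqrtr_sqr. Qed.

Lemma cabs_nat k : cabs (k%:R : R[i]) = k%:R.
Proof.
by rewrite -(rmorph_nat (real_complex R)) [LHS]cabs_real ger0_norm.
Qed.

Lemma ler_cabs_dist x y : cabs x <= cabs y + cabs (x - y).
Proof. by rewrite -{1}(subrK y x) addrC ler_cabsD. Qed.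

End ComplexModulus.

Section MultiIndices.
Variables (R : realType) (n : nat).
Implicit Types (nu mu : mindex n) (s : seq (mindex n)).

Definition deg nu : nat := (\sum_i nu i)%N.

Definition emb N (m : {ffun 'I_n -> 'I_N}) : mindex n :=
  [ffun i => nat_of_ord (m i)].

(** A duplicate-free list of exponents, unlike the function-indexed [box_sum], can be compared with
    arbitrary finite families of exponents. *)
Definition box N : seq (mindex n) := [seq emb m | m : {ffun 'I_n -> 'I_N}].

Lemma emb_inj N : injective (@emb N).
Proof.
move=> m1 m2 /ffunP h; apply/ffunP => i.
by have := h i; rewrite !ffunE => /val_inj.
Qed.

Lemma box_uniq N : uniq (box N).
Proof. by rewrite map_inj_uniq ?enum_uniq //; exact: emb_inj. Qed.

Lemma mem_box N nu : (nu \in box N) = [forall i, nu i < N]%N.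
Proof.
apply/idP/forallP => [/mapP[m _ ->] i|h]; first by rewrite ffunE.
apply/mapP; exists [ffun i => Ordinal (h i)]; first by rewrite mem_enum.
by apply/ffunP => i; rewrite !ffunE.
Qed.

Lemma box_sumE (F : mindex n -> R[i]) N : box_sum F N = \sum_(nu <- box N) F nu.
Proof. by rewrite /box big_map big_enum. Qed.

Lemma box_sumRE (F : mindex n -> R) N :
  box_sumR F N = \sum_(nu <- box N) F nu.
Proof. by rewrite /box big_map big_enum. Qed.

Lemma subset_box s : exists N0, forall N, (N0 <= N)%N -> {subset s <= box N}.
Proof.
exists (\max_(nu <- s) \max_i (nu i).+1)%N => N hN nu nus.
rewrite mem_box; apply/forallP => i; apply: leq_trans hN.
rewrite (big_rem _ nus) /= (bigD1 i) //=; lia.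
Qed.

Lemma deg_ge nu i : (nu i <= deg nu)%N.
Proof. by rewrite /deg (bigD1 i) //= leq_addr. Qed.

Lemma addidxE nu mu i : addidx nu mu i = (nu i + mu i)%N.
Proof. by rewrite ffunE. Qed.

Lemma addidxC nu mu : addidx nu mu = addidx mu nu.
Proof. by apply/ffunP => i; rewrite !addidxE addnC. Qed.

Lemma addidx_inj mu : injective (fun nu => addidx nu mu).
Proof.
move=> n1 n2 /ffunP h; apply/ffunP => i.
by have := h i; rewrite !addidxE => /addIn.
Qed.

Lemma ps_monomD nu mu (z : cvec R n) :
  ps_monom (addidx nu mu) z = ps_monom nu z * ps_monom mu z.
Proof.
by rewrite /ps_monom -big_split /=; apply: eq_bigr => i _; rewrite addidxE exprD.
Qed.

Lemma ps_monom_unit j (z : cvec R n) : ps_monom (unitidx j) z = z j.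
Proof.
rewrite /ps_monom (bigD1 j) //= big1 ?mulr1 ?ffunE ?eqxx ?expr1 // => i /negbTE h.
by rewrite ffunE h expr0.
Qed.

Lemma deg_addidx nu mu : deg (addidx nu mu) = (deg nu + deg mu)%N.
Proof. by rewrite /deg -big_split /=; apply: eq_bigr => i _; rewrite addidxE. Qed.

Lemma deg_unit j : deg (unitidx j) = 1%N.
Proof.
rewrite /deg (bigD1 j) //= big1 ?ffunE ?eqxx // => i /negbTE h.
by rewrite ffunE h.
Qed.

Lemma cabs_monom_le r nu (z : cvec R n) :
  (forall i, cabs (z i) <= r) -> cabs (ps_monom nu z) <= r ^+ deg nu.
Proof.
move=> h; rewrite /ps_monom cabs_prod /deg expr_sum.
by apply: ler_prod => i _; rewrite cabsX exprn_ge0 ?cabs_ge0 //= lerXn2r ?nnegrE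
  ?cabs_ge0 // (le_trans (cabs_ge0 (z i))).
Qed.

Lemma monom_const nu (r : R) : 0 <= r ->
  cabs (ps_monom nu (fun=> r%:C%C)) = r ^+ deg nu.
Proof.
move=> r0; rewrite /ps_monom cabs_prod /deg expr_sum.
by apply: eq_bigr => i _; rewrite cabsX cabs_real ger0_norm.
Qed.

End MultiIndices.

Lemma ler_sum_subseq (R : numDomainType) (T : eqType) (s1 s2 : seq T) (F : T -> R) :
  uniq s1 -> {subset s1 <= s2} -> (forall x, 0 <= F x) ->
  \sum_(x <- s1) F x <= \sum_(x <- s2) F x.
Proof.
elim: s1 s2 => [|x s1 IH] s2 /=; first by move=> _ _ F0; rewrite big_nil sumr_ge0.
move=> /andP[xs u] h F0; have xs2 : x \in s2 by apply: h; rewrite mem_head.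
rewrite big_cons (big_rem _ xs2) /= lerD2l; apply: IH => // y ys.
have : y \in s2 by apply: h; rewrite inE ys orbT.
rewrite (perm_mem (perm_to_rem xs2)) inE => /orP[/eqP yx|//].
by rewrite -yx ys in xs.
Qed.

Lemma eq_sum_subset (V : zmodType) (T : eqType) (s1 s2 : seq T) (F : T -> V) :
  uniq s1 -> uniq s2 -> {subset s1 <= s2} ->
  (forall x, x \in s2 -> x \notin s1 -> F x = 0) ->
  \sum_(x <- s2) F x = \sum_(x <- s1) F x.
Proof.
move=> u1 u2 h F0; rewrite (bigID (mem s1)) /= [X in _ + X]big1_seq ?addr0; last first.
  by move=> x /andP[xs xs2]; exact: F0.
rewrite -big_filter; apply: perm_big; apply: uniq_perm => //.
  exact: filter_uniq.
by move=> x; rewrite mem_filter /=; case: (boolP (x \in s1)) => //= /h.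
Qed.

(** * Absolute convergence with the degree as a weight *)

Section WeightedBound.
Variables (R : realType) (n : nat) (c : powser R n).

(** Since [nu j <= deg nu], one bound controls every z_j df/dz_j at once, and [r < 1] lets powers of
    [r] be compared through degrees. *)
Definition summable_at (r D : R) : Prop :=
  [/\ 0 < r, r < 1, 0 < D & forall s : seq (mindex n), uniq s ->
    \sum_(nu <- s) (deg nu)%:R * cabs (c nu) * r ^+ deg nu <= D].

(* Halving the radius of absolute convergence absorbs the factor [deg nu]. *)
Lemma ps_convergent_summable : ps_convergent c -> exists r D, summable_at r D.
Proof.
case=> r0 [r0_gt0 hr0].
(* The vector with all entries [p] has norm at most [n * p], which is strictly below [(n.+1) * p],
   hence below [r0]. *)
pose p : R := Num.min 1 (r0 / (n.+1)%:R).
have p0 : 0 < p by rewrite lt_min ltr01 divr_gt0.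
have p1 : p <= 1 by rewrite ge_min lexx.
have pr0 : vnorm (fun _ : 'I_n => p%:C%C) < r0.
  have -> : vnorm (fun _ : 'I_n => p%:C%C) = Num.sqrt (n%:R * p ^+ 2).
    rewrite /vnorm; congr Num.sqrt.
    by rewrite sumr_const /cabs2 /= expr0n addr0 card_ord mulr_natl.
  apply: (@le_lt_trans _ _ (n%:R * p)).
    rewrite -[leRHS]ger0_norm ?mulr_ge0 ?(ltW p0) // -sqrtr_sqr ler_sqrt ?sqr_ge0 //.
    rewrite exprMn ler_wpM2r ?sqr_ge0 //.
    by rewrite -natrX ler_nat; case: (n) => // k; rewrite leq_pmulr.
  apply: (@lt_le_trans _ _ ((n.+1)%:R * p)).
    by rewrite ltr_pM2r // ltr_nat.
  by rewrite mulrC -ler_pdivlMr // ge_min lexx orbT.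
have [M hM] := hr0 _ pr0.
have half k : (k%:R * (1 / 2) ^+ k : R) <= 1.
  rewrite expr_div_n expr1n mul1r ler_pdivrMr ?exprn_gt0 // mul1r -natrX ler_nat.
  exact: ltnW (ltn_expl _ _).
exists (p / 2), (Num.max M 1); split.
- by rewrite divr_gt0.
- by rewrite ltr_pdivrMr // mul1r (le_lt_trans p1) // ltr1n.
- by rewrite lt_max ltr01 orbT.
move=> s us; rewrite le_max; apply/orP; left.
have [N /(_ N (leqnn _)) hN] := subset_box s.
apply: le_trans (hM N); rewrite box_sumRE.
apply: le_trans (ler_sum_subseq us hN _); last first.
  by move=> nu; rewrite mulr_ge0 ?cabs_ge0.
apply: ler_sum => nu _; rewrite monom_const ?(ltW p0) //.
rewrite [_ * cabs _]mulrC -mulrA ler_wpM2l ?cabs_ge0 //.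
rewrite exprMn mulrCA -[leRHS]mulr1 ler_wpM2l ?exprn_ge0 ?(ltW p0) //.
by have := half (deg nu); rewrite div1r.
Qed.

End WeightedBound.

(** * Faces of the Newton polyhedron *)

Section NewtonFaces.
Variables (R : realType) (n : nat) (c : powser R n).
Implicit Types (P x : 'rV[R^o]_n) (nu : mindex n).

Definition axidx (j : 'I_n) (m : nat) : mindex n :=
  [ffun i => if i == j then m else 0%N].

Lemma dotR_rvec P nu : dotR P (rvec R nu) = \sum_i P 0 i * (nu i)%:R.
Proof. by apply: eq_bigr => i _; rewrite mxE. Qed.

Lemma Gamma_plus_rvec nu : c nu != 0 -> Gamma_plus c (rvec R nu).
Proof.
move=> cnu; exists [:: nu], (fun=> 1); split => //.
- by move=> mu; rewrite inE => /eqP ->; rewrite inE.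
- by rewrite big_seq1.
- by move=> i; rewrite big_seq1 mul1r mxE.
Qed.

(** A point of the polyhedron dominates coordinatewise a convex combination of exponents, and a
    nonnegative weight is monotone in each coordinate. *)
Lemma dotR_Gamma_plus_ge P d : nonneg_w P ->
  (forall nu, c nu != 0 -> d <= dotR P (rvec R nu)) ->
  forall x, Gamma_plus c x -> d <= dotR P x.
Proof.
move=> P0 hd x [s [lam [ss lam0 lam1 hx]]].
apply: (@le_trans _ _ (\sum_(nu <- s) lam nu * dotR P (rvec R nu))).
  rewrite -[d]mul1r -lam1 mulr_suml !big_seq; apply: ler_sum => nu nus.
  by rewrite ler_wpM2l //; apply: hd; have := ss _ nus; rewrite inE.
under eq_bigr do rewrite dotR_rvec mulr_sumr.
rewrite exchange_big /=; apply: ler_sum => i _.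
under eq_bigr do rewrite mulrCA.
by rewrite -mulr_sumr ler_wpM2l.
Qed.

Lemma dP_le P x : nonneg_w P -> Gamma_plus c x -> dP P c <= dotR P x.
Proof.
move=> P0 gx; apply: ge_inf; last by exists x.
exists 0 => _ [y gy <-]; apply: dotR_Gamma_plus_ge gy => // nu _.
by rewrite dotR_rvec; apply: sumr_ge0 => i _; rewrite mulr_ge0.
Qed.

Lemma dP_eq P d v0 : nonneg_w P ->
  (forall nu, c nu != 0 -> d <= dotR P (rvec R nu)) ->
  c v0 != 0 -> dotR P (rvec R v0) = d -> dP P c = d.
Proof.
move=> P0 hd cv0 ev0; apply/eqP; rewrite eq_le; apply/andP; split.
  by rewrite -ev0; apply: dP_le => //; exact: Gamma_plus_rvec.
apply: lb_le_inf.
  by exists (dotR P (rvec R v0)), (rvec R v0) => //; exact: Gamma_plus_rvec.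
by move=> _ [y gy <-]; exact: dotR_Gamma_plus_ge hd _ gy.
Qed.

(** Computing the minimum over the polyhedron on exponents alone replaces the infimum and the face
    by a test of one equation per exponent. *)
Lemma face_funE P d v0 : nonneg_w P ->
  (forall nu, c nu != 0 -> d <= dotR P (rvec R nu)) ->
  c v0 != 0 -> dotR P (rvec R v0) = d ->
  forall nu, face_fun P c nu = if dotR P (rvec R nu) == d then c nu else 0.
Proof.
move=> P0 hd cv0 ev0 nu; have dE := dP_eq P0 hd cv0 ev0.
rewrite /face_fun; have [->|cnu] := eqVneq (c nu) 0; first by rewrite !if_same.
congr (if _ then _ else _); apply/asboolP/eqP => [[_ ->]//|e].
by split; [exact: Gamma_plus_rvec | rewrite dE].
Qed.

(* Moving along the i-th axis does not leave a face with [P 0 i = 0]. *)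
Lemma compact_face_strictpos P x :
  nonneg_w P -> compact (DeltaP P c) -> DeltaP P c x -> strictpos_w P.
Proof.
move=> P0 cpt [gx dx] i; rewrite lt_neqAle P0 andbT eq_sym; apply/negP => /eqP Pi0.
pose y (t : R) : 'rV[R^o]_n := \row_k (x 0 k + (if k == i then t else 0)).
have yD t : 0 <= t -> DeltaP P c (y t).
  move=> t0; split.
    case: gx => s [lam [ss lam0 lam1 hx]]; exists s, lam; split => // k.
    by rewrite mxE (le_trans (hx k)) // lerDl; case: ifP.
  rewrite -dx; apply: eq_bigr => k _; rewrite mxE mulrDr.
  by case: eqP => [->|_]; rewrite ?Pi0 ?mul0r ?mulr0 ?addr0.
have [M [_ /(_ (`|M| + 1))]] := compact_bounded cpt.
rewrite (le_lt_trans (ler_norm M)) ?ltrDl // => /(_ isT) hM.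
(* With this [t] the i-th coordinate of [y t] is at least [|M| + 2], beyond the bound [|M| + 1] on
   the face. *)
pose t := `|M| + 2 + `|x 0 i|.
have t0 : 0 <= t by rewrite !addr_ge0.
have /= := hM _ (yD t t0).
have : `|y t 0 i| <= `|y t|.
  rewrite [leRHS]/Num.norm /= mx_normrE.
  by rewrite (le_bigmax _ (fun ij : 'I_1 * 'I_n => `|y t ij.1 ij.2|) (0, i)).
rewrite mxE eqxx => h1 h2; have := le_trans h1 h2.
have := ler_norm (x 0 i + t); have := ler_norm (- x 0 i); rewrite normrN /t.
by lra.
Qed.

(** The axis point dominates a convex combination of exponents. Its zero coordinates force those of
    positive coefficient onto the axis, and one of them has j-th coordinate at most [b]; minimality
    of the weight, with [P 0 j] positive by compactness of the face, gives equality. So [b] is the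
    order of f on the axis. *)
Lemma Newton_axis j b : Newton_boundary c (axis_pt j b) ->
  exists m : nat, [/\ b = m%:R, c (axidx j m) != 0 &
    forall k, c (axidx j k) != 0 -> (m <= k)%N].
Proof.
case=> P [P0 cpt Dx]; have Pp := compact_face_strictpos P0 cpt Dx.
have dotax k : dotR P (rvec R (axidx j k)) = P 0 j * k%:R.
  rewrite dotR_rvec (bigD1 j) //= big1 ?addr0 ?ffunE ?eqxx // => i /negbTE h.
  by rewrite ffunE h mulr0.
have dE : dP P c = P 0 j * b.
  case: Dx => _ <-; rewrite /dotR (bigD1 j) //= big1 ?addr0 ?mxE ?eqxx //.
  by move=> i /negbTE h; rewrite mxE h mulr0.
have minb k : c (axidx j k) != 0 -> b <= k%:R.
  move=> ck; have := dP_le P0 (Gamma_plus_rvec ck).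
  by rewrite dE dotax ler_pM2l.
case: Dx => [[s [lam [ss lam0 lam1 hx]]] _].
(* Otherwise the average of the j-th coordinates could stay at most [b] only if all coefficients
   vanished, against their sum being 1. *)
have [nu nus /andP[lnu nub]] : exists2 nu, nu \in s & (0 < lam nu) && ((nu j)%:R <= b).
  apply: contrapT => H.
  have hlt nu : nu \in s -> lam nu * b <= lam nu * (nu j)%:R ?= iff (lam nu == 0).
    move=> nus; have [->|l0] := eqVneq (lam nu) 0.
      by rewrite !mul0r; split; rewrite ?lexx ?eqxx.
    have lp : 0 < lam nu by rewrite lt_def l0 lam0.
    have bn : b < (nu j)%:R.
      by rewrite ltNge; apply/negP => nb; apply: H; exists nu => //; rewrite lp.
    split; first by rewrite ler_pM2l ?ltW.
    by apply/negbTE; rewrite lt_eqF // ltr_pM2l.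
  have bE : b = \sum_(nu <- s) lam nu * b by rewrite -mulr_suml lam1 mul1r.
  have := hx j; rewrite mxE eqxx bE => hle.
  have e : \sum_(nu <- s) lam nu * b = \sum_(nu <- s) lam nu * (nu j)%:R.
    apply/eqP; rewrite eq_le hle andbT !big_seq; apply: ler_sum => nu nus.
    by have [-> _] := hlt _ nus.
  have {}e : \sum_(nu <- s) (lam nu * (nu j)%:R - lam nu * b) = 0.
    by rewrite sumrB e subrr.
  have l0 nu : nu \in s -> lam nu = 0.
    move=> nus; apply/eqP; have [_ <-] := hlt _ nus; rewrite eq_sym -subr_eq0.
    move: e; rewrite big_seq => /eqP; rewrite psumr_eq0; last first.
      by move=> mu mus; have [h _] := hlt _ mus; rewrite subr_ge0.
    by move=> /allP /(_ _ nus); rewrite nus.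
  move: lam1; rewrite big_seq big1; last by move=> nu nus; rewrite l0.
  by move=> /eqP; rewrite eq_sym oner_eq0.
have nuE : nu = axidx j (nu j).
  apply/ffunP => i; rewrite ffunE; case: eqP => [->//|/eqP ij].
  have := hx i; rewrite mxE (negbTE ij) (big_rem _ nus) /= => h.
  have : lam nu * (nu i)%:R <= 0.
    apply: le_trans h; rewrite lerDl; apply: sumr_ge0 => mu _.
    by rewrite mulr_ge0.
  by rewrite pmulr_rle0 // => h1; apply/eqP; rewrite -leqn0 -(ler_nat R).
have cnu : c (axidx j (nu j)) != 0 by rewrite -nuE; have := ss _ nus; rewrite inE.
have be : b = (nu j)%:R by apply/eqP; rewrite eq_le nub minb.
exists (nu j); split => // k /minb; by rewrite be ler_nat.
Qed.

End NewtonFaces.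

(** * Compactness *)

(** The pseudo-inverse of [A] selects a preimage linearly, so its size is bounded by the image; [K]
    is the sum of the absolute values of all its entries. *)
Lemma bounded_row_preimage (R : realType) (n m : nat) (A : 'M[R]_(n, m)) :
  exists2 K : R, 0 <= K & forall (x : 'rV[R]_n) (T : R), 0 <= T ->
    (forall k, `|(x *m A) 0 k| <= T) ->
    exists2 y : 'rV[R]_n, y *m A = x *m A & forall i, `|y 0 i| <= K * T.
Proof.
pose B := pinvmx A; exists (\sum_i \sum_k `|B k i|).
  by apply: sumr_ge0 => i _; apply: sumr_ge0.
move=> x T T0 hT; exists (x *m A *m B); first exact: mulmxKpV (submxMl _ _).
move=> i; rewrite mxE (bigD1 i) //= mulrDl.
apply: (le_trans (ler_norm_sum _ _ _)); apply: ler_wpDr.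
  by rewrite mulr_ge0 //; apply: sumr_ge0 => k _; apply: sumr_ge0.
by rewrite mulr_suml; apply: ler_sum => k _; rewrite normrM mulrC ler_wpM2l.
Qed.

Section ComplexContinuity.
Variables (R : realType) (T : topologicalType).
Implicit Types F G : T -> R[i].

Definition ccontinuous F :=
  continuous (fun v => complex.Re (F v) : R) /\
  continuous (fun v => complex.Im (F v) : R).

Lemma ccontinuous_cst (a : R[i]) : ccontinuous (fun=> a).
Proof. by split=> v; exact: cvg_cst. Qed.

Lemma ccontinuousD F G : ccontinuous F -> ccontinuous G ->
  ccontinuous (fun v => F v + G v).
Proof.
move=> [F1 F2] [G1 G2]; split.
  rewrite (_ : (fun v => _) = (fun v => complex.Re (F v) + complex.Re (G v))).
    by move=> v; apply: cvgD; [exact: F1 | exact: G1].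
  by apply/funext => v; case: (F v) (G v) => [? ?] [? ?].
rewrite (_ : (fun v => _) = (fun v => complex.Im (F v) + complex.Im (G v))).
  by move=> v; apply: cvgD; [exact: F2 | exact: G2].
by apply/funext => v; case: (F v) (G v) => [? ?] [? ?].
Qed.

Lemma ccontinuousM F G : ccontinuous F -> ccontinuous G ->
  ccontinuous (fun v => F v * G v).
Proof.
move=> [F1 F2] [G1 G2]; split.
  rewrite (_ : (fun v => _) = (fun v => complex.Re (F v) * complex.Re (G v) -
      complex.Im (F v) * complex.Im (G v))).
    move=> v; apply: cvgB; apply: cvgM;
      [exact: F1 | exact: G1 | exact: F2 | exact: G2].
  by apply/funext => v; case: (F v) (G v) => [? ?] [? ?].
rewrite (_ : (fun v => _) = (fun v => complex.Re (F v) * complex.Im (G v) +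
    complex.Im (F v) * complex.Re (G v))).
  move=> v; apply: cvgD; apply: cvgM;
    [exact: F1 | exact: G2 | exact: F2 | exact: G1].
by apply/funext => v; case: (F v) (G v) => [? ?] [? ?].
Qed.

Lemma ccontinuous_sum (I : Type) (s : seq I) (P : pred I) (F : I -> T -> R[i]) :
  (forall i, ccontinuous (F i)) ->
  ccontinuous (fun v => \sum_(i <- s | P i) F i v).
Proof.
move=> h; elim: s => [|i s IH].
  rewrite (_ : (fun v => _) = fun=> 0); first exact: ccontinuous_cst.
  by apply/funext => v; rewrite big_nil.
rewrite (_ : (fun v => _) = fun v => (if P i then F i v else 0) +
   \sum_(i <- s | P i) F i v).
  apply: ccontinuousD => //; case: (P i) => //; exact: ccontinuous_cst.
by apply/funext => v; rewrite big_cons; case: (P i); rewrite ?add0r.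
Qed.

Lemma ccontinuousX F k : ccontinuous F -> ccontinuous (fun v => F v ^+ k).
Proof.
move=> h; elim: k => [|k IH].
  rewrite (_ : (fun v => _) = fun=> 1); first exact: ccontinuous_cst.
  by apply/funext => v; rewrite expr0.
rewrite (_ : (fun v => _) = fun v => F v * F v ^+ k); first exact: ccontinuousM.
by apply/funext => v; rewrite exprS.
Qed.

Lemma ccontinuous_prod (I : Type) (s : seq I) (P : pred I) (F : I -> T -> R[i]) :
  (forall i, ccontinuous (F i)) ->
  ccontinuous (fun v => \prod_(i <- s | P i) F i v).
Proof.
move=> h; elim: s => [|i s IH].
  rewrite (_ : (fun v => _) = fun=> 1); first exact: ccontinuous_cst.
  by apply/funext => v; rewrite big_nil.
rewrite (_ : (fun v => _) = fun v => (if P i then F i v else 1) *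
   \prod_(i <- s | P i) F i v).
  apply: ccontinuousM => //; case: (P i) => //; exact: ccontinuous_cst.
by apply/funext => v; rewrite big_cons; case: (P i); rewrite ?mul1r.
Qed.

Lemma continuous_cabs F : ccontinuous F -> continuous (fun v => cabs (F v)).
Proof.
move=> [F1 F2] v; rewrite /cabs /cabs2.
apply: (@continuous_comp _ _ _
  (fun v => complex.Re (F v) ^+ 2 + complex.Im (F v) ^+ 2) Num.sqrt).
  by apply: cvgD; rewrite !expr2; apply: cvgM;
    [exact: F1 | exact: F1 | exact: F2 | exact: F2].
exact: sqrt_continuous.
Qed.

End ComplexContinuity.

Lemma continuous_sumr (R : realType) (T : topologicalType) (I : Type) (s : seq I)
    (F : I -> T -> R) :
  (forall i, continuous (F i)) -> continuous (fun v => \sum_(i <- s) F i v).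
Proof.
move=> h; elim: s => [|i s IH].
  rewrite (_ : (fun v => _) = fun=> 0); first by move=> v; exact: cvg_cst.
  by apply/funext => v; rewrite big_nil.
rewrite (_ : (fun v => _) = fun v => F i v + \sum_(i <- s) F i v).
  by move=> v; apply: cvgD; [exact: h | exact: IH].
by apply/funext => v; rewrite big_cons.
Qed.

Section PolyannulusMin.
Variables (R : realType) (n : nat).

(** Coding a complex vector as a real row of double length makes compactness and the extreme value
    theorem for real rows available. *)
Definition row_cvec (v : 'rV[R]_(n + n)) : cvec R n :=
  fun i => Complex (v 0 (lshift n i)) (v 0 (rshift n i)).

Definition cvec_row (a : cvec R n) : 'rV[R]_(n + n) :=
  row_mx (\row_i complex.Re (a i)) (\row_i complex.Im (a i)).

Lemma cvec_rowK a : row_cvec (cvec_row a) = a.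
Proof.
by apply/funext => i; rewrite /row_cvec row_mxEl row_mxEr !mxE; case: (a i).
Qed.

Lemma ccontinuous_coord i : ccontinuous (fun v => row_cvec v i).
Proof. by split=> v; exact: coord_continuous. Qed.

Lemma cabs_ge_Re (z : R[i]) : `|complex.Re z| <= cabs z.
Proof.
by rewrite -sqrtr_sqr ler_sqrt ?addr_ge0 ?sqr_ge0 // lerDl sqr_ge0.
Qed.

Lemma cabs_ge_Im (z : R[i]) : `|complex.Im z| <= cabs z.
Proof.
by rewrite -sqrtr_sqr ler_sqrt ?addr_ge0 ?sqr_ge0 // lerDr sqr_ge0.
Qed.

(** The polyannulus is closed in a compact box, so the sum of moduli attains its minimum there, and
    that minimum is nonzero by the pointwise assumption. *)
Lemma polyannulus_min (G : 'I_n -> cvec R n -> R[i]) (k K : R) :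
  (forall j, ccontinuous (fun v => G j (row_cvec v))) ->
  (forall a, (forall i, k <= cabs (a i) <= K) -> exists j, G j a != 0) ->
  exists2 delta : R, 0 < delta & forall a, (forall i, k <= cabs (a i) <= K) ->
    delta <= \sum_j cabs (G j a).
Proof.
move=> Gc Gn0.
(* The extreme value theorem needs a nonempty set; on an empty polyannulus any [delta] works. *)
have [[a0 ha0]|none] := pselect (exists a : cvec R n, forall i, k <= cabs (a i) <= K);
  last by exists 1 => // a ha; case: none; exists a.
pose Q := [set v : 'rV[R]_(n + n) | forall i, k <= cabs (row_cvec v i) <= K].
have Qcpt : compact Q.
  have box_cpt := @rV_compact R (n + n) (fun=> `[- K, K]%classic)
    (fun=> @segment_compact R _ _).
  apply: subclosed_compact box_cpt _.
    rewrite (_ : Q = \bigcap_(i in setT)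
        ((fun v => cabs (row_cvec v i)) @^-1` `[k, K]%classic)).
      apply: closed_bigI => i _; apply: preimage_closed; last exact: itv_closed.
      move=> v _; exact/continuous_cabs/ccontinuous_coord.
    apply/seteqP; split=> v /= h i; first by move=> _; rewrite /= in_itv; exact: h.
    by have := h i I; rewrite /= in_itv.
  move=> v hv i; rewrite /= in_itv /= -ler_norml.
  case: (splitP i) => j ij.
    have -> : i = lshift n j by apply: val_inj.
    by have /andP[_] := hv j; exact: le_trans (cabs_ge_Re (row_cvec v j)).
  have -> : i = rshift n j by apply: val_inj.
  by have /andP[_] := hv j; exact: le_trans (cabs_ge_Im (row_cvec v j)).
pose h (v : 'rV[R]_(n + n)) := \sum_j cabs (G j (row_cvec v)).
have hc : continuous h.
  by apply: continuous_sumr => j; exact: continuous_cabs.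
have Q0 : Q !=set0 by exists (cvec_row a0) => i; rewrite cvec_rowK.
have [v Qv vmin] := EVT_min_rV Q0 Qcpt (continuous_subspaceT hc).
exists (h v).
  have [j Gj] := Gn0 (row_cvec v) (set_mem Qv).
  rewrite /h (bigD1 j) //= ltr_wpDr ?cabs_gt0 //.
  by apply: sumr_ge0 => i _; exact: cabs_ge0.
move=> a ha; rewrite -[a]cvec_rowK; apply: vmin; rewrite inE => i.
by rewrite cvec_rowK.
Qed.

End PolyannulusMin.

(** * Truncation to the dominant monomials *)

Section PartialSums.
Variables (R : realType) (n : nat).
Implicit Types (c : powser R n) (z : cvec R n) (nu mu : mindex n).

(** These are the exponents in z_j times a partial sum of df/dz_j: multiplication by z_j restores
    the monomials of f, with factor [mu j]. *)
Definition shifted_box (j : 'I_n) N : seq (mindex n) :=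
  [seq addidx nu (unitidx j) | nu <- box n N].

Lemma shifted_box_uniq j N : uniq (shifted_box j N).
Proof. by rewrite map_inj_uniq ?box_uniq //; exact: addidx_inj. Qed.

Lemma mem_shifted_box j N mu :
  (0 < mu j)%N -> (forall i, mu i < N)%N -> mu \in shifted_box j N.
Proof.
move=> mj h; apply/mapP; exists [ffun i => (mu i - (i == j))%N].
  by rewrite mem_box; apply/forallP => i; rewrite ffunE (leq_ltn_trans (leq_subr _ _)).
apply/ffunP => i; rewrite addidxE !ffunE subnK //.
by case: eqP => [->|].
Qed.

Lemma mul_box_sum_dcoef c j z N :
  z j * box_sum (fun nu => dcoef j c nu * ps_monom nu z) N =
  \sum_(mu <- shifted_box j N) (mu j)%:R * c mu * ps_monom mu z.
Proof.
rewrite box_sumE mulr_sumr [RHS]big_map; apply: eq_bigr => nu _.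
rewrite ps_monomD ps_monom_unit addidxE /dcoef ffunE eqxx addn1.
set t := (nu j).+1%:R; ring.
Qed.

Lemma ps_has_sum_mul_dist c j z w (g : R[i]) (e : R) :
  ps_has_sum (dcoef j c) z w ->
  (exists N0, forall N, (N0 <= N)%N ->
    cabs (\sum_(mu <- shifted_box j N) (mu j)%:R * c mu * ps_monom mu z - g) <= e) ->
  cabs (z j * w - g) <= e.
Proof.
move=> hw [N0 hN0]; apply/ler_addgt0Pr => d d0.
(* Adding 1 keeps the denominator positive when [z j] is zero. *)
have d1 : 0 < d / (cabs (z j) + 1) by rewrite divr_gt0 // ltr_wpDl ?cabs_ge0.
have [N1 hN1] := hw _ d1; pose N := maxn N0 N1.
have := hN0 N (leq_maxl _ _); rewrite -mul_box_sum_dcoef.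
have := hN1 N (leq_maxr _ _); set s := box_sum _ _ => h1 h2.
rewrite (_ : _ - g = (z j * s - g) + - (z j * (s - w))); last by ring.
apply: (le_trans (ler_cabsD _ _)); rewrite cabsN lerD // cabsM.
apply: (@le_trans _ _ ((cabs (z j) + 1) * cabs (s - w))).
  by rewrite ler_wpM2r ?cabs_ge0 // lerDl.
by rewrite mulrC -ler_pdivlMr ?ltW // ltr_wpDl ?cabs_ge0.
Qed.

End PartialSums.

(** * Monomials inside and outside the box *)

Section NewtonBox.
Variables (R : realType) (n : nat) (c : powser R n) (N : nat) (mm : 'I_n -> nat).
Hypothesis mm_le : forall k, (mm k <= N)%N.
Hypothesis c_axis : forall k, c (axidx k (mm k)) != 0.

Local Notation W := {ffun 'I_n -> 'I_N.+1}.
Implicit Types (S : {set W}) (m : W) (z a : cvec R n).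

Definition box_support : {set W} := [set m | c (emb m) != 0].

(** This is M(z); the default [0] does not affect a maximum of moduli. *)
Definition max_monom z : R :=
  \big[Num.max/0]_(m in box_support) cabs (ps_monom (emb m) z).

(** When [S] is the set of exponents of f_P, this is z_j df_P/dz_j. *)
Definition log_grad S (j : 'I_n) z : R[i] :=
  \sum_(m in S) (emb m j)%:R * c (emb m) * ps_monom (emb m) z.

Lemma max_monom_ge m z : m \in box_support ->
  cabs (ps_monom (emb m) z) <= max_monom z.
Proof.
move=> mV; rewrite /max_monom.
by rewrite (le_bigmax_cond _ (fun m => cabs (ps_monom (emb m) z))). Qed.

Lemma max_monom_ge0 z : 0 <= max_monom z.
Proof. exact: bigmax_ge_id. Qed.

Lemma emb_axis k : exists2 m : W, m \in box_support & emb m = axidx k (mm k).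
Proof.
have /mapP[m _ hm] : axidx k (mm k) \in box n N.+1.
  by rewrite mem_box; apply/forallP => i; rewrite ffunE; case: eqP; rewrite ?ltnS ?mm_le.
by exists m => //; rewrite inE -hm.
Qed.

Lemma monom_axidx k p z : ps_monom (axidx k p) z = z k ^+ p.
Proof.
rewrite /ps_monom (bigD1 k) //= big1 ?mulr1 ?ffunE ?eqxx // => i /negbTE h.
by rewrite ffunE h expr0.
Qed.

Lemma max_monom_axis k z : cabs (z k) ^+ mm k <= max_monom z.
Proof.
have [m mV me] := emb_axis k.
by rewrite -cabsX -monom_axidx -me max_monom_ge.
Qed.

Lemma max_monom_gt0 z k : z k != 0 -> 0 < max_monom z.
Proof.
by move=> zk; apply: lt_le_trans (max_monom_axis k z); rewrite exprn_gt0 ?cabs_gt0.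
Qed.

Lemma max_monom_attained z : 0 < max_monom z ->
  exists2 m, m \in box_support & cabs (ps_monom (emb m) z) = max_monom z.
Proof.
move=> M0; apply: contrapT => H.
suff : max_monom z < max_monom z by rewrite ltxx.
rewrite {1}/max_monom; apply/bigmax_ltP; split=> // m mV.
rewrite lt_neqAle max_monom_ge // andbT; apply/eqP => e; apply: H.
by exists m.
Qed.

(** Some coordinate of [mu] exceeds [N], hence [mm k], so the monomial is divisible by z_k^(mm k)
    z_k. As M(z) bounds the first factor, the second one makes the monomial negligible near the
    origin. *)
Lemma off_box_split mu : mu \notin box n N.+1 -> exists k rho,
  mu = addidx (addidx (axidx k (mm k)) (unitidx k)) rho.
Proof.
rewrite mem_box negb_forall => /existsP[k]; rewrite -leqNgt => hk.
exists k, [ffun i => if i == k then (mu i - (mm k).+1)%N else mu i].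
apply/ffunP => i; rewrite !addidxE !ffunE; case: eqP => [->|_] //=.
by have := mm_le k; move: hk; lia.
Qed.

Lemma in_box_emb mu : mu \in box n N.+1 -> exists m : W, mu = emb m.
Proof. by case/mapP => m _ ->; exists m. Qed.

Lemma deg_emb m : (deg (emb m) <= n * N)%N.
Proof.
rewrite /deg (@leq_trans (\sum_(i < n) N)%N) //; last first.
  by rewrite sum_nat_const card_ord.
by apply: leq_sum => i _; rewrite ffunE -ltnS.
Qed.

(** The summand [n * N] bounds degrees in the box and [N.+1] the degree of the factor split off
    outside it, so one power of [r] serves both cases. *)
Definition degree_bound : nat := (n * N + N.+1)%N.

(** In the box, [tau] bounds the ratio of a monomial outside [S] to M(z); outside the box, the extra
    factor z_k contributes [eta]. Comparison with [r ^+ deg mu] then makes the whole tail summable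
    with total at most [D]. *)
Lemma cabs_log_grad_tail S r D eta tau z (s : seq (mindex n)) j :
  summable_at c r D -> 0 <= eta -> eta <= r -> 0 <= tau ->
  (forall i, cabs (z i) <= eta) ->
  (forall m, m \in box_support -> m \notin S ->
     cabs (ps_monom (emb m) z) <= tau * max_monom z) ->
  uniq s -> (forall m, m \in S -> emb m \notin s) ->
  cabs (\sum_(mu <- s) (mu j)%:R * c mu * ps_monom mu z) <=
    D / r ^+ degree_bound * (tau + eta) * max_monom z.
Proof.
move=> [r0 r1 D0 hD] eta0 etar tau0 hz hoff us sS.
set L := degree_bound; set M := max_monom z; have M0 : 0 <= M := max_monom_ge0 z.
have rL0 k : 0 < r ^+ k by rewrite exprn_gt0.
apply: (le_trans (ler_cabs_sum _ _ _)).
apply: (@le_trans _ _ (\sum_(mu <- s)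
   ((deg mu)%:R * cabs (c mu) * r ^+ deg mu) * ((tau + eta) * M / r ^+ L))); last first.
  rewrite -mulr_suml [leRHS](_ : _ = D * ((tau + eta) * M / r ^+ L)); last by ring.
  by rewrite ler_wpM2r ?hD ?divr_ge0 ?mulr_ge0 ?addr_ge0 // ltW.
rewrite !big_seq; apply: ler_sum => mu mus; rewrite !cabsM cabs_nat.
have [->|cmu] := eqVneq (c mu) 0; first by rewrite cabs0 !(mul0r, mulr0).
suff h : cabs (ps_monom mu z) <= r ^+ deg mu * ((tau + eta) * M / r ^+ L).
  rewrite -[leRHS]mulrA ler_pM ?mulr_ge0 ?cabs_ge0 //.
  by rewrite ler_wpM2r ?cabs_ge0 // ler_nat deg_ge.
rewrite mulrA ler_pdivlMr // mulrC.
have [/in_box_emb[m em]|/off_box_split[k [rho em]]] := boolP (mu \in box n N.+1).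
  have mV : m \in box_support by rewrite inE -em.
  have mS : m \notin S by apply/negP => /sS; rewrite -em mus.
  apply: ler_pM; rewrite ?cabs_ge0 ?(ltW (rL0 _)) //.
    by rewrite ler_wiXn2l ?(ltW r0) ?(ltW r1) // em (leq_trans (deg_emb _)) // leq_addr.
  by rewrite em (le_trans (hoff _ mV mS)) // ler_wpM2r // lerDl.
rewrite em !ps_monomD monom_axidx ps_monom_unit !cabsM cabsX.
have hrho : cabs (ps_monom rho z) <= r ^+ deg rho.
  by apply: cabs_monom_le => i; exact: le_trans etar.
have degE : (deg (addidx (addidx (axidx k (mm k)) (unitidx k)) rho) <= L + deg rho)%N.
  rewrite !deg_addidx deg_unit leq_add2r (_ : deg (axidx k (mm k)) = mm k).
    by have := mm_le k; rewrite /L /degree_bound; lia.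
  rewrite /deg (bigD1 k) //= big1 ?addn0 ?ffunE ?eqxx // => i /negbTE h.
  by rewrite ffunE h.
apply: (@le_trans _ _ (r ^+ L * (M * eta * r ^+ deg rho))).
  rewrite ler_wpM2l ?(ltW (rL0 _)) // ler_pM ?mulr_ge0 ?exprn_ge0 ?cabs_ge0 //.
  by rewrite ler_pM ?exprn_ge0 ?cabs_ge0 //; exact: max_monom_axis.
rewrite [leLHS](_ : _ = r ^+ (L + deg rho) * (eta * M)); last by rewrite exprD; ring.
apply: ler_pM; rewrite ?mulr_ge0 ?(ltW (rL0 _)) //.
  by rewrite ler_wiXn2l ?(ltW r0) ?(ltW r1).
by rewrite ler_wpM2r // lerDr.
Qed.

(** Exponents not involving z_j carry the factor 0 in [log_grad] and never occur in [shifted_box],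
    so they are dropped to obtain an inclusion. *)
Definition active_indices S j : seq (mindex n) :=
  [seq mu : mindex n <- [seq emb m | m <- enum S] | mu j != 0%N].

Lemma active_indices_uniq S j : uniq (active_indices S j).
Proof. by rewrite filter_uniq // map_inj_uniq ?enum_uniq //; exact: emb_inj. Qed.

Lemma mem_active_indices S j mu : (mu \in active_indices S j) =
  (mu j != 0%N) && [exists m in S, emb m == mu].
Proof.
rewrite mem_filter; congr (_ && _); apply/mapP/existsP => [[m]|[m /andP[mS /eqP <-]]].
  by rewrite mem_enum => mS ->; exists m; rewrite mS eqxx.
by exists m => //; rewrite mem_enum.
Qed.

Lemma log_gradE S j z : log_grad S j z =
  \sum_(mu <- active_indices S j) (mu j)%:R * c mu * ps_monom mu z.
Proof.
rewrite /log_grad -big_enum -(big_map (@emb n N.+1) xpredT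
  (fun mu : mindex n => (mu j)%:R * c mu * ps_monom mu z)).
rewrite (bigID (fun mu : mindex n => mu j == 0%N)) /=.
rewrite big1 ?add0r => [|mu /eqP ->]; last by rewrite !mul0r.
by rewrite -big_filter.
Qed.

Lemma active_indices_sub S j N' : (N < N')%N ->
  {subset active_indices S j <= shifted_box j N'}.
Proof.
move=> hN' mu; rewrite mem_active_indices => /andP[mj /existsP[m /andP[_ /eqP em]]].
apply: mem_shifted_box; first by rewrite lt0n.
by move=> i; rewrite -em ffunE (leq_trans (ltn_ord _)).
Qed.

Lemma cabs_grad_dist S r D eta tau z w j :
  summable_at c r D -> 0 <= eta -> eta <= r -> 0 <= tau ->
  (forall i, cabs (z i) <= eta) ->
  (forall m, m \in box_support -> m \notin S ->
     cabs (ps_monom (emb m) z) <= tau * max_monom z) ->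
  ps_has_sum (dcoef j c) z w ->
  cabs (z j * w - log_grad S j z) <=
    D / r ^+ degree_bound * (tau + eta) * max_monom z.
Proof.
move=> hrD eta0 etar tau0 hz hoff hw; apply: ps_has_sum_mul_dist hw _.
exists N.+1 => N' hN'; pose P mu := [exists m in S, emb m == mu].
(* The exponents coming from [S] give exactly [log_grad] once the box is large enough; the others
   form the tail. *)
rewrite (bigID P) /= -big_filter -[X in _ + X - _]big_filter.
rewrite (_ : \sum_(mu <- _) _ = log_grad S j z); last first.
  rewrite log_gradE; apply: eq_sum_subset.
  - exact: active_indices_uniq.
  - by rewrite filter_uniq // shifted_box_uniq.
  - move=> mu muA; rewrite mem_filter (active_indices_sub hN' muA) andbT.
    by move: muA; rewrite mem_active_indices => /andP[].
  - move=> mu; rewrite mem_filter mem_active_indices -/(P mu) => /andP[-> _].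
    by rewrite andbT negbK => /eqP ->; rewrite !mul0r.
rewrite addrAC subrr add0r; apply: (@cabs_log_grad_tail S) => //.
  by rewrite filter_uniq // shifted_box_uniq.
move=> m mS; rewrite mem_filter negb_and negbK; apply/orP; left.
by apply/existsP; exists m; rewrite mS eqxx.
Qed.

(** Only finitely many coefficients of [c'] are nonzero, so the partial sums are eventually
    constant, and dividing by the nonzero [a j] turns a zero of [log_grad] into a zero of the
    derivative. *)
Lemma face_grad_has_sum S (c' : powser R n) a j :
  (forall nu, c' nu = if [exists m in S, emb m == nu] then c nu else 0) ->
  a j != 0 -> log_grad S j a = 0 -> ps_has_sum (dcoef j c') a 0.
Proof.
move=> hc' aj g0 e e0; exists N.+1 => N' hN'; rewrite subr0.
suff -> : box_sum (fun nu => dcoef j c' nu * ps_monom nu a) N' = 0 by rewrite cabs0.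
apply: (mulfI aj); rewrite mulr0 mul_box_sum_dcoef -[RHS]g0 log_gradE.
rewrite [RHS](_ : _ = \sum_(mu <- active_indices S j)
   (mu j)%:R * c' mu * ps_monom mu a); last first.
  rewrite !big_seq; apply: eq_bigr => mu; rewrite mem_active_indices hc'.
  by move=> /andP[_ ->].
apply: eq_sum_subset; [exact: active_indices_uniq | exact: shifted_box_uniq |
  exact: active_indices_sub | move=> mu _].
rewrite mem_active_indices negb_and negbK => /orP[/eqP ->|/negbTE h].
  by rewrite !mul0r.
by rewrite hc' h mulr0 mul0r.
Qed.

End NewtonBox.

(** * Logarithmic coordinates and rescaling in the torus *)

Section TorusRescaling.
Variables (R : realType) (n : nat) (c : powser R n) (N : nat) (mm : 'I_n -> nat).
Hypothesis mm_le : forall k, (mm k <= N)%N.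
Hypothesis c_axis : forall k, c (axidx k (mm k)) != 0.

Local Notation W := {ffun 'I_n -> 'I_N.+1}.
Implicit Types (S : {set W}) (m : W) (z a : cvec R n) (nu mu : mindex n).

Lemma dotR_addidx (P : 'rV[R^o]_n) nu mu :
  dotR P (rvec R (addidx nu mu)) = dotR P (rvec R nu) + dotR P (rvec R mu).
Proof.
rewrite !dotR_rvec -big_split /=; apply: eq_bigr => i _.
by rewrite addidxE natrD mulrDr.
Qed.

Lemma dotR_unit (P : 'rV[R^o]_n) k : dotR P (rvec R (unitidx k)) = P 0 k.
Proof.
rewrite dotR_rvec (bigD1 k) //= big1 ?addr0 ?ffunE ?eqxx ?mulr1 // => i /negbTE h.
by rewrite ffunE h mulr0.
Qed.

Lemma dotR_rvec_ge0 (P : 'rV[R^o]_n) nu : nonneg_w P -> 0 <= dotR P (rvec R nu).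
Proof. by move=> P0; rewrite dotR_rvec; apply: sumr_ge0 => i _; rewrite mulr_ge0. Qed.

Lemma dotRB (x y : 'rV[R^o]_n) nu :
  dotR (x - y) (rvec R nu) = dotR x (rvec R nu) - dotR y (rvec R nu).
Proof.
rewrite !dotR_rvec -sumrB; apply: eq_bigr => i _.
by rewrite !mxE mulrBl.
Qed.

(** The sign makes the entries positive near the origin, so that this row is almost a weight: moduli
    of monomials are exponentials of minus its values. *)
Definition logrow z : 'rV[R^o]_n := \row_i (- ln (cabs (z i)) : R).

Lemma cabs_monom_expR z nu : (forall i, z i != 0) ->
  cabs (ps_monom nu z) = expR (- dotR (logrow z) (rvec R nu)).
Proof.
move=> z0; rewrite dotR_rvec -sumrN expR_sum cabs_prod; apply: eq_bigr => i _.
rewrite mxE mulNr opprK mulrC expRM_natl lnK ?cabsX //.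
by rewrite posrE cabs_gt0.
Qed.

Lemma monom_scale z a (P : 'rV[R^o]_n) nu :
  (forall i, a i = z i * (expR (P 0 i))%:C%C) ->
  ps_monom nu a = ps_monom nu z * (expR (dotR P (rvec R nu)))%:C%C.
Proof.
move=> ha; rewrite dotR_rvec expR_sum (rmorph_prod (real_complex R)) /ps_monom.
rewrite -big_split /=; apply: eq_bigr => i _.
rewrite ha exprMn; congr (_ * _).
by rewrite mulrC expRM_natl (rmorphXn (real_complex R)).
Qed.

(** Checking exponents in the box suffices: any other one exceeds some [axidx k (mm k)], which lies
    in the box, by a weight of at least [P 0 k > 0]. *)
Lemma strictpos_face S v0 (P : 'rV[R^o]_n) :
  strictpos_w P -> S \subset box_support c N -> v0 \in S ->
  (forall m, m \in S -> dotR P (rvec R (emb m)) = dotR P (rvec R (emb v0))) ->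
  (forall m, m \in box_support c N -> m \notin S ->
     dotR P (rvec R (emb v0)) < dotR P (rvec R (emb m))) ->
  forall nu, face_fun P c nu = if [exists m in S, emb m == nu] then c nu else 0.
Proof.
move=> Pp SV v0S hS hoff; have P0 : nonneg_w P by move=> i; exact: ltW.
have cS m : m \in S -> c (emb m) != 0 by move=> /(fintype.subsetP SV); rewrite inE.
have hlt nu : c nu != 0 -> ~~ [exists m in S, emb m == nu] ->
    dotR P (rvec R (emb v0)) < dotR P (rvec R nu).
  move=> cnu nS; have [/in_box_emb[m em]|] := boolP (nu \in box n N.+1).
    rewrite em; apply: hoff; first by rewrite inE -em.
    by apply: contra nS => mS; apply/existsP; exists m; rewrite mS em eqxx.
  move=> /(off_box_split mm_le)[k [rho ->]]; rewrite !dotR_addidx dotR_unit.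
  have [m mV <-] := emb_axis mm_le c_axis k.
  have hm : dotR P (rvec R (emb v0)) <= dotR P (rvec R (emb m)).
    by have [/hS ->//|mS] := boolP (m \in S); exact/ltW/hoff.
  by rewrite -addrA (le_lt_trans hm) // ltrDl ltr_wpDr ?dotR_rvec_ge0.
have hE nu : c nu != 0 -> (dotR P (rvec R nu) == dotR P (rvec R (emb v0))) =
    [exists m in S, emb m == nu].
  move=> cnu; have [/existsP[m /andP[mS /eqP <-]]|h] := boolP
      [exists m in S, emb m == nu].
    by rewrite hS ?eqxx.
  by rewrite gt_eqF ?hlt.
have hle nu : c nu != 0 -> dotR P (rvec R (emb v0)) <= dotR P (rvec R nu).
  move=> cnu; have [/existsP[m /andP[mS /eqP <-]]|h] :=
    boolP [exists m in S, emb m == nu]; first by rewrite hS.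
  exact/ltW/hlt.
move=> nu; rewrite (face_funE P0 hle (cS _ v0S) erefl).
by have [->|cnu] := eqVneq (c nu) 0; rewrite ?if_same // hE.
Qed.

(* Taking logarithms, the monomials of [S] are nearly constant, so correcting
   [logrow z] by a bounded row [y] yields a weight [P] constant on [S], and [z]
   is a torus point of bounded modulus pushed by the one-parameter group of [P]. *)
Lemma torus_rescaling S v0 (T : R) :
  S \subset box_support c N -> v0 \in S -> 0 <= T ->
  exists tau0 eps0 k1 K1 k2 : R, [/\ 0 < tau0, 0 < eps0, 0 < k1, 0 < k2 &
  forall z M, (forall i, z i != 0) -> (forall i, cabs (z i) < eps0) -> 0 < M ->
    (forall m, m \in S -> cabs (ps_monom (emb m) z) <= M) ->
    (forall m, m \in S -> expR (- T) * M <= cabs (ps_monom (emb m) z)) ->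
    (forall m, m \in box_support c N -> m \notin S ->
       cabs (ps_monom (emb m) z) <= tau0 * M) ->
  exists (P : 'rV[R^o]_n) a s, [/\ strictpos_w P,
    forall nu, face_fun P c nu = if [exists m in S, emb m == nu] then c nu else 0,
    forall i, k1 <= cabs (a i) <= K1, k2 * M <= s &
    forall m, m \in S -> ps_monom (emb m) z = s%:C%C * ps_monom (emb m) a]].
Proof.
move=> SV v0S T0.
(* A row is killed by [A] exactly when its weight is constant on [S]. *)
pose A : 'M[R]_(n, #|{: W}|) := \matrix_(i, k)
  if enum_val k \in S then (emb (enum_val k) i)%:R - (emb v0 i)%:R else 0.
have mulA (x : 'rV[R]_n) k : (x *m A) 0 k = if enum_val k \in S then
    dotR x (rvec R (emb (enum_val k))) - dotR x (rvec R (emb v0)) else 0.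
  rewrite mxE; case: ifP => kS; last first.
    by rewrite big1 // => i _; rewrite mxE kS mulr0.
  rewrite !dotR_rvec -sumrB; apply: eq_bigr => i _.
  by rewrite mxE kS mulrBr.
have [K K0 hK] := bounded_row_preimage A.
pose Y := K * T; have Y0 : 0 <= Y by rewrite mulr_ge0.
pose Y1 := (n * N)%:R * Y; have Y10 : 0 <= Y1 by rewrite mulr_ge0.
have doty (y : 'rV[R]_n) m : (forall i, `|y 0 i| <= Y) ->
    `|dotR y (rvec R (emb m))| <= Y1.
  move=> hy; rewrite dotR_rvec (le_trans (ler_norm_sum _ _ _)) //.
  apply: (@le_trans _ _ (\sum_i (emb m i)%:R * Y)).
    apply: ler_sum => i _; rewrite normrM normr_nat mulrC ler_wpM2l //.
  by rewrite -mulr_suml -natr_sum ler_wpM2r // ler_nat deg_emb.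
(* The correction [y] has entries at most [Y] and changes the weight of an exponent in the box by at
   most [Y1]. The first constant leaves a gap of at least 1 between [S] and the other weights, the
   second makes every [P 0 i] positive, and the rest bound [a] and [s]. *)
exists (expR (- (T + Y1 + Y1 + 1))), (expR (- Y)), (expR (- Y)), (expR Y),
  (expR (- (T + Y1))).
split; rewrite ?expR_gt0 // => z M z0 zeps M0 hM hS hoff.
pose x := logrow z; pose d nu := dotR x (rvec R nu).
have [l lM] : exists l, M = expR (- l) by exists (- ln M); rewrite opprK lnK.
have dM m : m \in S -> l <= d (emb m).
  by move=> /hM; rewrite cabs_monom_expR // lM ler_expR lerN2.
have dS m : m \in S -> d (emb m) <= T + l.
  by move=> /hS; rewrite cabs_monom_expR // lM -expRD ler_expR -opprD lerN2.
have doff m : m \in box_support c N -> m \notin S -> T + Y1 + Y1 + 1 + l <= d (emb m).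
  move=> mV mS; have := hoff m mV mS.
  by rewrite cabs_monom_expR // lM -expRD ler_expR -opprD lerN2.
have hxA k : `|(x *m A) 0 k| <= T.
  rewrite mulA; case: ifP => kS; last by rewrite normr0.
  have := dM _ kS; have := dS _ kS; have := dM _ v0S; have := dS _ v0S.
  by rewrite -/(d _) -/(d _) ler_norml; move=> *; apply/andP; split; lra.
have [y yA yY] := hK x T T0 hxA.
pose P : 'rV[R^o]_n := x - y.
have dP' nu : dotR P (rvec R nu) = d nu - dotR y (rvec R nu) by rewrite dotRB.
have PS m : m \in S -> dotR P (rvec R (emb m)) = dotR P (rvec R (emb v0)).
  move=> mS; have /rowP/(_ (enum_rank m)) := yA; rewrite !mulA enum_rankK mS.
  by rewrite !dP' /d; lra.
have Pp : strictpos_w P.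
  move=> i; rewrite !mxE subr_gt0; have := yY i; rewrite ler_norml => /andP[_ h].
  apply: (le_lt_trans h); rewrite ltrNr -ltr_expR lnK ?zeps //.
  by rewrite posrE cabs_gt0.
have Poff m : m \in box_support c N -> m \notin S ->
    dotR P (rvec R (emb v0)) < dotR P (rvec R (emb m)).
  move=> mV mS; rewrite !dP'.
  have := doff _ mV mS; have := dS _ v0S.
  have := doty y m yY; have := doty y v0 yY; rewrite !ler_norml.
  by move=> /andP[? ?] /andP[? ?] ? ?; lra.
(* Multiplying by the exponential of [P] cancels [logrow z], so the modulus of [a i] depends on [y]
   alone. *)
pose a : cvec R n := fun i => z i * (expR (P 0 i))%:C%C.
have aE i : cabs (a i) = expR (- y 0 i).
  rewrite cabsM cabs_real gtr0_norm ?expR_gt0 // !mxE expRD expRN lnK ?posrE ?cabs_gt0 //.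
  by rewrite mulrA mulfV ?mul1r // cabs_eq0.
exists P, a, (expR (- dotR P (rvec R (emb v0)))); split => //.
- exact: strictpos_face PS Poff.
- by move=> i; rewrite aE !ler_expR -ler_norml normrN; exact: yY.
- rewrite lM -expRD ler_expR dP'.
  have := dS _ v0S; have := doty y v0 yY; rewrite !ler_norml.
  by move=> /andP[? ?] ?; lra.
move=> m mS; rewrite (@monom_scale z a P) // mulrCA -(rmorphM (real_complex R)) /=.
by rewrite PS // -expRD addNr expR0 mulr1.
Qed.

End TorusRescaling.

(** * The gradient estimate *)

Section GradientBound.
Variables (R : realType) (n : nat) (c : powser R n) (N : nat) (mm : 'I_n -> nat).
Hypothesis mm_le : forall k, (mm k <= N)%N.
Hypothesis c_axis : forall k, c (axidx k (mm k)) != 0.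

Local Notation W := {ffun 'I_n -> 'I_N.+1}.
Local Notation V := (box_support c N).
Local Notation M := (max_monom c N).
Implicit Types (S : {set W}) (m : W) (z a : cvec R n) (nu mu : mindex n).

(** Radius and constant share the parameter [e], so that the condition is monotone in it. *)
Definition violates (e : R) z : Prop :=
  [/\ exists i, z i != 0, forall i, cabs (z i) < e &
    exists2 w, forall j, ps_has_sum (dcoef j c) z (w j) &
      \sum_j cabs (z j * w j) < e * M z].

Lemma violates_le e1 e2 z : e1 <= e2 -> violates e1 z -> violates e2 z.
Proof.
move=> e12 [z0 hz [w hw h]]; split=> //.
  by move=> i; exact: lt_le_trans (hz i) e12.
by exists w => //; apply: lt_le_trans h _; rewrite ler_wpM2r ?max_monom_ge0.
Qed.

(* A maximal set [S] of monomials that stay comparable to the largest one along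
   violators tending to 0; by maximality the others become negligible. *)
Lemma dominant_monomials : (forall e, 0 < e -> exists z, violates e z) ->
  exists S (T : R), [/\ S \subset V, 0 <= T &
    forall tau e, 0 < tau -> 0 < e -> exists2 z, violates e z &
      (forall m, m \in S -> expR (- T) * M z <= cabs (ps_monom (emb m) z)) /\
      (forall m, m \in V -> m \notin S -> cabs (ps_monom (emb m) z) <= tau * M z)].
Proof.
move=> viol.
(* One [T] must serve for violators arbitrarily close to the origin; the empty set qualifies by
   assumption. *)
pose Psi S := S \subset V /\ exists2 T : R, 0 <= T & forall e, 0 < e ->
  exists2 z, violates e z &
    forall m, m \in S -> expR (- T) * M z <= cabs (ps_monom (emb m) z).
have Psi0 : `[< Psi finset.set0 >].
  apply/asboolP; split; first exact: finset.sub0set.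
  by exists 0 => // e e0; have [z vz] := viol e e0; exists z => // m; rewrite inE.
have [S /maxsetP[/asboolP[SV [T T0 hT]] Smax] _] :=
  @maxset_exists _ (fun S => `[< Psi S >]) _ Psi0.
exists S, T; split => // tau e tau0 e0.
pose T' := Num.max T (- ln tau).
have TT' : expR (- T') <= expR (- T) by rewrite ler_expR lerN2 le_max lexx.
have tauT' : expR (- T') <= tau.
  by rewrite -[leRHS]lnK ?posrE // ler_expR lerNl le_max lexx orbT.
(* Without such an [e'], the monomial [m] would stay above the threshold for violators at every
   scale, so [m |: S] would satisfy [Psi] with [T'], against maximality. *)
have epsP m : exists e' : R, 0 < e' /\ (m \in V -> m \notin S ->
    forall z, violates e' z ->
    (forall m, m \in S -> expR (- T) * M z <= cabs (ps_monom (emb m) z)) ->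
    cabs (ps_monom (emb m) z) < expR (- T') * M z).
  have [mV|mV] := boolP (m \in V); last by exists 1.
  have [mS|mS] := boolP (m \in S); first by exists 1.
  apply: contrapT => H.
  suff /Smax : `[< Psi (m |: S)%SET >].
    by move=> /(_ (finset.subsetUr _ _)) e'; move: mS; rewrite -e' setU11.
  apply/asboolP; split.
    by rewrite finset.subUset finset.sub1set mV.
  exists T'; first by rewrite le_max T0.
  move=> e' e'0; apply: contrapT => H'; apply: H; exists e'; split => // _ _ z vz hz.
  rewrite ltNge; apply/negP => hm; apply: H'; exists z => // m'.
  rewrite !inE => /orP[/eqP -> //|/hz]; apply: le_trans.
  by rewrite ler_wpM2r ?max_monom_ge0.
have [eps heps] := choice epsP.
pose e' := \big[Num.min/e]_m eps m.
have e'0 : 0 < e'.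
  by apply/bigmin_gtP; split=> // m _; have [] := heps m.
have [z vz hz] := hT e' e'0.
exists z; first by apply: violates_le vz; exact: bigmin_le_id.
split=> // m mV mS.
have [_ /(_ mV mS z)] := heps m.
have /violates_le : e' <= eps m by rewrite /e' bigmin_le_cond.
move=> /(_ z vz) vz' /(_ vz' hz)/ltW /le_trans; apply.
by rewrite ler_wpM2r ?max_monom_ge0.
Qed.

(* Zero coordinates are replaced by tiny ones: the monomials not vanishing at
   [z] do not change, the others stay small. *)
Lemma torus_perturbation z (d : R) : 0 < d -> d <= 1 ->
  (forall i, cabs (z i) <= 1) ->
  exists z' : cvec R n, [/\ forall i, z' i != 0,
    forall i, cabs (z' i) <= Num.max d (cabs (z i)) &
    forall nu, (ps_monom nu z != 0 -> ps_monom nu z' = ps_monom nu z) /\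
      (cabs (ps_monom nu z') <= Num.max d (cabs (ps_monom nu z)))].
Proof.
move=> d0 d1 z1; pose z' : cvec R n := fun i => if z i == 0 then d%:C%C else z i.
have cd : cabs d%:C%C = d by rewrite cabs_real gtr0_norm.
have z'0 i : z' i != 0.
  by rewrite /z'; case: ifP => [_|/negbT//]; rewrite -cabs_gt0 cd.
have z'1 i : cabs (z' i) <= 1 by rewrite /z'; case: ifP; rewrite ?cd.
exists z'; split=> //.
  by move=> i; rewrite /z'; case: ifP; rewrite ?cd le_max lexx ?orbT.
have same nu : ps_monom nu z != 0 -> ps_monom nu z' = ps_monom nu z.
  move=> /prodf_neq0 h; apply: eq_bigr => i _; have := h i isT.
  by rewrite expf_eq0 /z'; case: (nu i) => [|k]; rewrite ?expr0 //= => /negbTE ->.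
move=> nu; split; first exact: same.
have [nz|/same ->] := eqVneq (ps_monom nu z) 0; last by rewrite le_max lexx orbT.
(* A vanishing monomial contains a replaced coordinate to a positive power, which contributes at
   most [d]; the other factors are at most 1. *)
have /eqP := nz; rewrite /ps_monom prodf_seq_eq0 => /hasP[i _] /=.
rewrite expf_eq0 => /andP[nui zi0].
rewrite le_max; apply/orP; left; rewrite /ps_monom (bigD1 i) //= cabsM cabsX.
rewrite -[leRHS]mulr1 ler_pM ?exprn_ge0 ?cabs_ge0 //.
    rewrite /z' zi0 cd; case: (nu i) nui => // k _.
  by rewrite exprS -[leRHS]mulr1 ler_wpM2l ?exprn_ile1 ?(ltW d0).
rewrite cabs_prod; apply: prodr_ile1 => k _.
by rewrite cabsX exprn_ge0 ?exprn_ile1 ?cabs_ge0.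
Qed.

Lemma log_gradient_bound r D : summable_at c r D -> non_degenerate c ->
  exists2 e : R, 0 < e & forall z w, (exists i, z i != 0) ->
    (forall i, cabs (z i) < e) -> (forall j, ps_has_sum (dcoef j c) z (w j)) ->
    e * M z <= \sum_j cabs (z j * w j).
Proof.
move=> hrD nd; apply: contrapT => H.
have viol e : 0 < e -> exists z, violates e z.
  move=> e0; apply: contrapT => H'; apply: H; exists e => // z w z0 ze hw.
  rewrite leNgt; apply/negP => h; apply: H'; exists z; split => //.
  by exists w.
have [S [T [SV T0 hS]]] := dominant_monomials viol.
have Mpos z e : violates e z -> 0 < M z.
  by case=> -[i zi] _ _; exact: (max_monom_gt0 mm_le c_axis zi).
(* For [tau = 1/2], a monomial attaining M(z) cannot lie outside [S]. *)
have [v0 v0S] : exists v0, v0 \in S.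
  have [z vz [_ hoff]] := hS (1 / 2) 1 (divr_gt0 ltr01 (ltr0n _ 2)) ltr01.
  have [m mV em] := max_monom_attained (Mpos _ _ vz).
  exists m; apply/negPn/negP => mS; have := hoff m mV mS.
  by have := Mpos _ _ vz; rewrite em; lra.
have [tau0 [eps0 [k1 [K1 [k2 [tau00 eps00 k10 k20 resc]]]]]] :=
  torus_rescaling mm_le c_axis SV v0S T0.
(* Rescaling is extended to violators with zero coordinates by perturbing them: monomials of [S] do
   not vanish at [z], hence keep their values, and [d] is small enough to preserve the other
   bounds. *)
have {}resc z e tau : violates e z -> e <= eps0 -> e <= 1 -> tau <= tau0 ->
    (forall m, m \in S -> expR (- T) * M z <= cabs (ps_monom (emb m) z)) ->
    (forall m, m \in V -> m \notin S -> cabs (ps_monom (emb m) z) <= tau * M z) ->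
  exists (P : 'rV[R^o]_n) a s, [/\ strictpos_w P,
    forall nu, face_fun P c nu = if [exists m in S, emb m == nu] then c nu else 0,
    forall i, k1 <= cabs (a i) <= K1, k2 * M z <= s &
    forall m, m \in S -> ps_monom (emb m) z = s%:C%C * ps_monom (emb m) a].
  move=> vz ee0 e1 tt0 zS zoff; have Mz := Mpos _ _ vz.
  pose d := Num.min 1 (Num.min (eps0 / 2) (tau0 * M z)).
  have d0 : 0 < d by rewrite !lt_min ltr01 divr_gt0 ?mulr_gt0.
  have [_ ze _] := vz.
  have [||z' [z'0 z'e z'm]] := @torus_perturbation z d d0.
  - by rewrite ge_min lexx.
  - by move=> i; rewrite ltW // (lt_le_trans (ze i)).
  have z'S m : m \in S -> ps_monom (emb m) z' = ps_monom (emb m) z.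
    move=> mS; have [h _] := z'm (emb m); apply: h; rewrite -cabs_gt0.
    by apply: lt_le_trans (zS m mS); rewrite mulr_gt0 ?expR_gt0.
  have [||||P [a [s [P1 P2 P3 P4 P5]]]] := resc z' (M z) z'0 _ Mz.
  - move=> i; apply: le_lt_trans (z'e i) _; rewrite gt_max (lt_le_trans (ze i)) // andbT.
    by rewrite /d !gt_min; apply/orP; right; apply/orP; left; lra.
  - by move=> m mS; rewrite z'S // max_monom_ge //; exact: (fintype.subsetP SV).
  - by move=> m mS; rewrite z'S // zS.
  - move=> m mV mS; have [_ h] := z'm (emb m); apply: le_trans h _.
    rewrite ge_max {1}/d !ge_min lexx !orbT /=.
    by rewrite (le_trans (zoff m mV mS)) // ler_wpM2r // ltW.
  by exists P, a, s; split => // m mS; rewrite -z'S // P5.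
pose e1 := Num.min 1 eps0.
have e10 : 0 < e1 by rewrite lt_min ltr01.
(* This first violator only supplies a weight with face [S], so that [delta] is fixed before [e] is
   chosen. *)
have [z1 vz1 [z1S z1off]] := hS tau0 e1 tau00 e10.
have [P [_ [_ [Pp Pface _ _ _]]]] : exists (P : 'rV[R^o]_n) a s, [/\ strictpos_w P,
    forall nu, face_fun P c nu = if [exists m in S, emb m == nu] then c nu else 0,
    forall i, k1 <= cabs (a i) <= K1, k2 * M z1 <= s &
    forall m, m \in S -> ps_monom (emb m) z1 = s%:C%C * ps_monom (emb m) a].
  by apply: (resc z1 e1 tau0) => //; rewrite ge_min lexx ?orbT.
have Gc j : ccontinuous (fun v : 'rV[R]_(n + n) => log_grad c S j (row_cvec v)).
  apply: ccontinuous_sum => m; apply: ccontinuousM; first exact: ccontinuous_cst.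
  by apply: ccontinuous_prod => i; apply: ccontinuousX; exact: ccontinuous_coord.
have [delta delta0 hdelta] : exists2 delta : R, 0 < delta &
    forall a, (forall i, k1 <= cabs (a i) <= K1) ->
    delta <= \sum_j cabs (log_grad c S j a).
  apply: polyannulus_min Gc _ => a ha; apply: contrapT => Ha.
  have a0 i : a i != 0.
    by rewrite -cabs_gt0; have /andP[h _] := ha i; exact: lt_le_trans h.
  apply: (nd P Pp); exists a; split => // j.
  apply: (face_grad_has_sum Pface (a0 j)); apply/eqP/negPn/negP => h; apply: Ha.
  by exists j.
have [r0 r1 D0 _] := hrD.
pose C0 := D / r ^+ degree_bound n N.
have C00 : 0 < C0 by rewrite divr_gt0 // exprn_gt0.
(* The product [e * q] is the desired [e] plus [n] truncation errors [C0 * (e + e)]; keeping it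
   below [k2 * delta] yields the contradiction. *)
pose q := n%:R * C0 * 2 + 1.
have q0 : 0 < q.
  rewrite /q; apply: ltr_wpDl => //; by rewrite mulr_ge0 // mulr_ge0 // ltW.
pose e := Num.min (Num.min 1 eps0) (Num.min (Num.min tau0 r) (k2 * delta / q)).
have kd0 : 0 < k2 * delta / q by rewrite divr_gt0 ?mulr_gt0.
have e0 : 0 < e by rewrite !lt_min ltr01 eps00 tau00 r0.
have [z vz [zS zoff]] := hS e e e0 e0.
have [e_le1 e_eps0 e_tau0] : [/\ e <= 1, e <= eps0 & e <= tau0].
  by split; rewrite /e !ge_min lexx ?orbT.
have [P' [a [s [_ _ ha hs zma]]]] := resc z e e vz e_eps0 e_le1 e_tau0 zS zoff.
have M0 := Mpos _ _ vz; have s0 : 0 < s by apply: lt_le_trans hs; rewrite mulr_gt0.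
case: vz => _ ze [w hw]; apply/negP; rewrite -leNgt.
have gE j : log_grad c S j z = s%:C%C * log_grad c S j a.
  rewrite /log_grad mulr_sumr; apply: eq_bigr => m mS.
  by rewrite zma // mulrCA.
have hdist j : cabs (log_grad c S j z) <= cabs (z j * w j) + C0 * (e + e) * M z.
  apply: le_trans (ler_cabs_dist _ (z j * w j)) _; rewrite lerD2l -cabsN opprB.
  apply: (cabs_grad_dist mm_le c_axis hrD) => //.
  - exact: ltW.
  - by rewrite /e !ge_min lexx !orbT.
  - exact: ltW.
  - by move=> i; exact: ltW.
have hsum : k2 * M z * delta <= \sum_j cabs (log_grad c S j z).
  apply: (@le_trans _ _ (s * delta)); first by rewrite ler_pM2r.
  under eq_bigr do rewrite gE cabsM cabs_real gtr0_norm //.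
  by rewrite -mulr_sumr ler_pM2l // hdelta.
have : k2 * M z * delta <= \sum_j cabs (z j * w j) + n%:R * (C0 * (e + e) * M z).
  apply: (le_trans hsum); rewrite -[n in n%:R]card_ord mulr_natl -sumr_const -big_split.
  by apply: ler_sum => j _; exact: hdist.
have eq : e * q <= k2 * delta by rewrite -ler_pdivlMr // /e !ge_min lexx !orbT.
have {}eq : e * q * M z <= k2 * delta * M z by rewrite ler_pM2r.
rewrite -lerBlDr => h; apply: le_trans h; rewrite lerBrDr.
rewrite [leRHS](_ : _ = k2 * delta * M z); last by ring.
apply: le_trans eq; rewrite /q.
by rewrite [leRHS](_ : _ = e * M z + n%:R * (C0 * (e + e) * M z)) //; ring.
Qed.

End GradientBound.

(** * The two bounds on the exponent *)

Lemma complex_Re_sum (R : realType) (I : Type) (s : seq I) (F : I -> R[i]) :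
  complex.Re (\sum_(i <- s) F i) = \sum_(i <- s) complex.Re (F i).
Proof. by apply: (big_morph (@complex.Re R)) => // -[? ?] [? ?]. Qed.

Lemma complex_Im_sum (R : realType) (I : Type) (s : seq I) (F : I -> R[i]) :
  complex.Im (\sum_(i <- s) F i) = \sum_(i <- s) complex.Im (F i).
Proof. by apply: (big_morph (@complex.Im R)) => // -[? ?] [? ?]. Qed.

Lemma cabs_le_ReIm (R : realType) (z : R[i]) :
  cabs z <= `|complex.Re z| + `|complex.Im z|.
Proof.
rewrite -[leRHS]ger0_norm ?addr_ge0 // -sqrtr_sqr ler_sqrt ?sqr_ge0 //.
rewrite /cabs2 -[X in X + _]real_normK ?num_real // -[X in _ + X]real_normK ?num_real //.
by rewrite sqrrD lerD2r lerDl mulrn_wge0 ?mulr_ge0.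
Qed.

Lemma cvg_series_abs (R : realType) (u : nat -> R) (D : R) :
  (forall N, \sum_(0 <= k < N) `|u k| <= D) ->
  exists l : R, forall e, 0 < e -> exists N0, forall N, (N0 <= N)%N ->
    `|\sum_(0 <= k < N) u k - l| < e.
Proof.
move=> hD; have /normed_cvg cv : cvgn [normed series u].
  apply: nondecreasing_is_cvgn.
    apply/nondecreasing_seqP => N; rewrite -[leRHS]/(\sum_(0 <= k < N.+1) `|u k|).
    by rewrite big_nat_recr //= lerDl.
  by exists D => _ [N _ <-]; exact: hD.
exists (limn (series u)) => e e0.
move/cvgrPdist_lt: cv => /(_ e e0)[N0 _ h].
by exists N0 => N /h /=; rewrite distrC.
Qed.

Lemma cvg_complex_series (R : realType) (g : nat -> R[i]) (D : R) :
  (forall N, \sum_(0 <= k < N) cabs (g k) <= D) ->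
  exists w : R[i], forall e, 0 < e -> exists N0, forall N, (N0 <= N)%N ->
    cabs (\sum_(0 <= k < N) g k - w) < e.
Proof.
move=> hD.
have [|l1 h1] := @cvg_series_abs R (fun k => complex.Re (g k)) D.
  by move=> N; apply: le_trans (hD N); apply: ler_sum => k _; exact: cabs_ge_Re.
have [|l2 h2] := @cvg_series_abs R (fun k => complex.Im (g k)) D.
  by move=> N; apply: le_trans (hD N); apply: ler_sum => k _; exact: cabs_ge_Im.
exists (Complex l1 l2) => e e0; have e2 : 0 < e / 2 by rewrite divr_gt0.
have [N1 {}h1] := h1 _ e2; have [N2 {}h2] := h2 _ e2.
exists (maxn N1 N2) => N; rewrite geq_max => /andP[/h1 {}h1 /h2 {}h2].
apply: le_lt_trans (cabs_le_ReIm _) _; move: h1 h2.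
rewrite -complex_Re_sum -complex_Im_sum; case: (\sum_(_ <= _ < _) _) => x y /=.
by move=> *; lra.
Qed.

Section VectorNorm.
Variables (R : realType) (n : nat).
Implicit Types z : cvec R n.

Lemma cabs2E (x : R[i]) : cabs2 x = cabs x ^+ 2.
Proof. by rewrite sqr_sqrtr // addr_ge0 ?sqr_ge0. Qed.

Lemma vnorm_ge0 z : 0 <= vnorm z.
Proof. exact: sqrtr_ge0. Qed.

Lemma cabs_le_vnorm z i : cabs (z i) <= vnorm z.
Proof.
have h0 j : 0 <= cabs2 (z j) by rewrite cabs2E sqr_ge0.
rewrite /vnorm ler_sqrt ?sumr_ge0 // (bigD1 i) //= lerDl.
by rewrite sumr_ge0.
Qed.

Lemma vnorm_le z rho : 0 <= rho -> (forall i, cabs (z i) <= rho) ->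
  vnorm z <= n%:R * rho.
Proof.
move=> rho0 h; rewrite -[leRHS]ger0_norm ?mulr_ge0 // -sqrtr_sqr ler_sqrt ?sqr_ge0 //.
apply: (@le_trans _ _ (n%:R * rho ^+ 2)).
  rewrite -[n in n%:R]card_ord mulr_natl -sumr_const; apply: ler_sum => i _.
  by rewrite cabs2E lerXn2r ?nnegrE ?cabs_ge0.
rewrite exprMn ler_wpM2r ?sqr_ge0 // -natrX ler_nat.
by case: (n) => // k; rewrite leq_pmulr.
Qed.

End VectorNorm.

(** * Upper bound from the gradient estimate *)

Section UpperBound.
Variables (R : realType) (n : nat) (c : powser R n) (mm : 'I_n -> nat).
Hypothesis c_axis : forall k, c (axidx k (mm k)) != 0.
Hypothesis mm_gt0 : forall k, (0 < mm k)%N.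

Lemma Loj_set_upper theta : (0 < n)%N -> ps_convergent c -> non_degenerate c ->
  0 < theta -> (forall k, (mm k)%:R - 1 <= theta) -> Loj_set c theta.
Proof.
move=> n0 /ps_convergent_summable[r [D hrD]] nd th0 hth.
have mm_le k : (mm k <= \max_j mm j)%N by exact: leq_bigmax.
have [e e0 he] := log_gradient_bound mm_le c_axis hrD nd.
have nR : 0 < n%:R :> R by rewrite ltr0n.
have nth : 0 < n%:R `^ theta by rewrite powR_gt0.
(* The norm of [z] is at most [n] times its largest modulus, which costs [n] to the power [theta];
   the other factor [n] comes from the sum over j. *)
split=> //; exists (e / (n%:R * n%:R `^ theta)), (Num.min e 1); split.
- by rewrite divr_gt0 // mulr_gt0.
- by rewrite lt_min e0 ltr01.
move=> z hz w hw.
have [z0|/existsNP[i0 /eqP zi0]] := pselect (forall i, z i = 0).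
  have -> : vnorm z = 0.
    apply/eqP; rewrite eq_le vnorm_ge0 andbT -(mulr0 n%:R) vnorm_le // => i.
    by rewrite z0 cabs0.
  by rewrite powR0 ?gt_eqF // mulr0 vnorm_ge0.
have [i _ imax] := @arg_maxP _ R _ i0 xpredT (fun i => cabs (z i)) isT.
set rho := cabs (z i) in imax; have {}imax j : cabs (z j) <= rho by exact: imax.
have rho0 : 0 < rho by apply: lt_le_trans (imax i0); rewrite cabs_gt0.
have hzi j : cabs (z j) < Num.min e 1 := le_lt_trans (cabs_le_vnorm z j) hz.
have rho1 : rho < 1 by have := hzi i; rewrite lt_min => /andP[].
have h1 : e * rho ^+ mm i <= rho * (n%:R * vnorm w).
  apply: (@le_trans _ _ (\sum_j cabs (z j * w j))).
    apply: le_trans (he z w _ _ hw); last 2 first.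
    - by exists i0.
    - by move=> j; have := hzi j; rewrite lt_min => /andP[].
    by rewrite ler_pM2l // (max_monom_axis mm_le c_axis).
  rewrite -[n in n%:R]card_ord mulr_natl -sumr_const mulr_sumr; apply: ler_sum => j _.
  by rewrite cabsM ler_pM ?cabs_ge0 // cabs_le_vnorm.
have h2 : e * rho `^ theta <= n%:R * vnorm w.
  apply: (@le_trans _ _ (e * rho ^+ (mm i).-1)).
    rewrite ler_pM2l // -powR_mulrn ?(ltW rho0) // ger_powR ?rho0 ?(ltW rho1) //.
    by have := hth i; rewrite -subn1 natrB.
  by rewrite -(ler_pM2l rho0) mulrCA -exprS prednK.
rewrite -(ler_pM2l nR); apply: le_trans h2.
rewrite [leLHS](_ : _ = e * (vnorm z `^ theta / n%:R `^ theta)); last first.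
  by field; rewrite !gt_eqF.
rewrite ler_pM2l // ler_pdivrMr // mulrC -powRM ?(ltW nR) ?(ltW rho0) //.
rewrite ge0_ler_powR ?(ltW th0) ?nnegrE ?vnorm_ge0 ?mulr_ge0 ?(ltW rho0) //.
by rewrite vnorm_le // ltW.
Qed.

End UpperBound.

(** * Lower bound along a coordinate axis *)

Section LowerBound.
Variables (R : realType) (n : nat) (c : powser R n) (i : 'I_n) (p : nat) (r D : R).
Hypothesis hrD : summable_at c r D.
Hypothesis c_low : forall j k, (k < p)%N -> dcoef j c (axidx i k) = 0.

Definition axis_vec (t : R) : cvec R n := fun k => if k == i then t%:C%C else 0.

Lemma vnorm_axis t : 0 <= t -> vnorm (axis_vec t) = t.
Proof.
move=> t0; rewrite /vnorm (bigD1 i) //= big1 => [|k /negbTE ki].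
  by rewrite /axis_vec eqxx cabs2E cabs_real addr0 sqrtr_sqr normr_id ger0_norm.
by rewrite /axis_vec ki cabs2E cabs0 expr0n.
Qed.

Lemma axidx_inj : injective (@axidx n i).
Proof. by move=> k l /ffunP/(_ i); rewrite !ffunE eqxx. Qed.

Lemma monom_axis_vec nu t : ps_monom nu (axis_vec t) =
  if nu == axidx i (nu i) then (t%:C%C) ^+ nu i else 0.
Proof.
rewrite /ps_monom (bigD1 i) //= {1}/axis_vec eqxx; case: eqP => [->|ne].
  rewrite big1 ?mulr1 ?ffunE ?eqxx // => k /negbTE ki.
  by rewrite ffunE ki expr0.
suff [k [ki nuk]] : exists k, k != i /\ (0 < nu k)%N.
  by rewrite (bigD1 k) //= /axis_vec (negbTE ki) expr0n gtn_eqF // mul0r mulr0.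
apply: contrapT => H; apply: ne; apply/ffunP => k; rewrite ffunE.
case: eqP => [->//|/eqP ki]; apply/eqP; rewrite -leqn0 leqNgt; apply/negP => h.
by apply: H; exists k.
Qed.

Lemma box_sum_axis j t N : (0 < N)%N ->
  box_sum (fun nu => dcoef j c nu * ps_monom nu (axis_vec t)) N =
  \sum_(0 <= k < N) dcoef j c (axidx i k) * (t%:C%C) ^+ k.
Proof.
move=> N0; rewrite box_sumE.
rewrite [RHS](_ : _ = \sum_(nu <- [seq axidx i k | k <- index_iota 0 N])
    dcoef j c nu * ps_monom nu (axis_vec t)); last first.
  rewrite big_map; apply: eq_bigr => k _.
  by rewrite monom_axis_vec !ffunE !eqxx.
apply: eq_sum_subset.
- by rewrite map_inj_uniq ?iota_uniq //; exact: axidx_inj.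
- exact: box_uniq.
- move=> nu /mapP[k]; rewrite mem_index_iota => /andP[_ kN] ->.
  by rewrite mem_box; apply/forallP => l; rewrite ffunE; case: ifP.
move=> nu; rewrite mem_box monom_axis_vec => /forallP hnu nuN.
case: eqP => [e|_]; last by rewrite mulr0.
by case/mapP: nuN; exists (nu i) => //; rewrite mem_index_iota; exact: hnu.
Qed.

(** The coefficients involved are those of f in degree [k.+1], whence the division by [r]; the
    factor from differentiation is at most this degree. *)
Lemma dcoef_axis_sum j N :
  \sum_(0 <= k < N) cabs (dcoef j c (axidx i k)) * r ^+ k <= D / r.
Proof.
have [r0 r1 D0 hD] := hrD.
rewrite ler_pdivlMr // mulr_suml.
have /hD : uniq [seq addidx (axidx i k) (unitidx j) | k <- index_iota 0 N].
  by rewrite map_inj_uniq ?iota_uniq // => k l /addidx_inj/axidx_inj.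
apply: le_trans; rewrite big_map; apply: ler_sum => k _.
have degE : deg (addidx (axidx i k) (unitidx j)) = k.+1.
  rewrite deg_addidx deg_unit addn1 /deg (bigD1 i) //= big1 ?ffunE ?eqxx ?addn0 //.
  by move=> l /negbTE li; rewrite ffunE li.
rewrite degE -[leLHS]mulrA -[in leLHS]exprSr ler_wpM2r ?exprn_ge0 ?(ltW r0) //.
rewrite cabsM cabs_nat ler_wpM2r ?cabs_ge0 // ler_nat ltnS ffunE.
by case: ifP.
Qed.

(** Existence of the sum matters, since the inequality in [Loj_set] speaks only of gradients that
    are sums. The bound holds because the series starts at order [p] and t/r < 1. *)
Lemma axis_grad j t : 0 < t -> t < r ->
  exists2 w, ps_has_sum (dcoef j c) (axis_vec t) w & cabs w <= D / r ^+ p.+1 * t ^+ p.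
Proof.
move=> t0 tr; have [r0 r1 D0 hD] := hrD.
pose g k := dcoef j c (axidx i k) * (t%:C%C) ^+ k.
have gle N : \sum_(0 <= k < N) cabs (g k) <= D / r ^+ p.+1 * t ^+ p.
  rewrite [leRHS](_ : _ = D / r * (t / r) ^+ p); last first.
    by rewrite expr_div_n exprS invfM; ring.
  apply: le_trans (ler_wpM2r _ (dcoef_axis_sum j N)); last first.
    by rewrite exprn_ge0 ?divr_ge0 ?(ltW t0) ?(ltW r0).
  rewrite mulr_suml; apply: ler_sum => k _; rewrite /g cabsM cabsX cabs_real gtr0_norm //.
  have [kp|pk] := ltnP k p; first by rewrite c_low // cabs0 !mul0r.
  rewrite -mulrA ler_wpM2l ?cabs_ge0 //.
  rewrite -{1}[t](divfK (lt0r_neq0 r0)) exprMn mulrC ler_wpM2l ?exprn_ge0 ?(ltW r0) //.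
  by rewrite ler_wiXn2l ?divr_ge0 ?(ltW t0) ?(ltW r0) // ler_pdivrMr // mul1r ltW.
have [w hw] := cvg_complex_series gle.
exists w.
  move=> e e0; have [N0 hN0] := hw e e0; exists N0.+1 => N hN.
  by rewrite box_sum_axis ?hN0 ?(leq_trans _ hN) // ltnW.
apply/ler_addgt0Pr => e e0; have [N0 /(_ _ (leqnn _)) hN0] := hw e e0.
apply: le_trans (ler_cabs_dist _ (\sum_(0 <= k < N0) g k)) _.
apply: lerD; last by rewrite -cabsN opprB ltW.
exact: le_trans (ler_cabs_sum _ _ _) (gle N0).
Qed.

Lemma Loj_set_lower theta : Loj_set c theta -> p%:R <= theta.
Proof.
case=> th0 [C [eps [C0 eps0 hC]]]; rewrite leNgt; apply/negP => thp.
have [r0 r1 D0 hD] := hrD.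
pose C2 := n%:R * (D / r ^+ p.+1).
have n0 : 0 < n%:R :> R by rewrite ltr0n; case: (n) (i) => // -[].
have C20 : 0 < C2 by rewrite mulr_gt0 // divr_gt0 // exprn_gt0.
pose kap := C / C2 / 2; have kap0 : 0 < kap by rewrite !divr_gt0.
pose q := p%:R - theta; have q0 : 0 < q by rewrite subr_gt0.
(* The last term makes [C2 * t ^ q] at most [C / 2], so the gradient at [t e_i] falls below
   [C * t ^ theta]. *)
pose t := Num.min (Num.min (eps / 2) (r / 2)) (kap `^ q^-1).
have t0 : 0 < t by rewrite !lt_min powR_gt0 // !divr_gt0.
have teps : t < eps.
  have : t <= eps / 2 by rewrite /t !ge_min lexx.
  by move: eps0; lra.
have tr : t < r.
  have : t <= r / 2 by rewrite /t !ge_min lexx orbT.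
  by move: r0; lra.
have /choice[w hw] : forall j, exists w,
    ps_has_sum (dcoef j c) (axis_vec t) w /\ cabs w <= D / r ^+ p.+1 * t ^+ p.
  by move=> j; have [w ? ?] := axis_grad j t0 tr; exists w.
have := hC (axis_vec t); rewrite vnorm_axis ?(ltW t0) //.
move=> /(_ teps w (fun j => (hw j).1)).
apply/negP; rewrite -ltNge.
apply: (@le_lt_trans _ _ (C2 * t ^+ p)).
  rewrite /C2 -mulrA vnorm_le // => [|j]; last by have [] := hw j.
  by rewrite mulr_ge0 ?divr_ge0 ?exprn_ge0 ?(ltW t0) ?(ltW r0) ?(ltW D0).
have -> : t ^+ p = t `^ theta * t `^ q.
  by rewrite -powRD ?subrKC ?powR_mulrn ?(ltW t0) // (gt_eqF t0) implybT.
rewrite mulrCA mulrC ltr_pM2r ?powR_gt0 //.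
have tq : t `^ q <= kap.
  have -> : kap = (kap `^ q^-1) `^ q.
    by rewrite -powRrM mulVf ?gt_eqF // powRr1 ?(ltW kap0).
  by rewrite ge0_ler_powR ?nnegrE ?powR_ge0 ?(ltW q0) ?(ltW t0) // /t ge_min lexx orbT.
apply: (@le_lt_trans _ _ (C2 * kap)); first by rewrite ler_pM2l.
rewrite [ltLHS](_ : _ = C / 2); first by move: C0; lra.
by rewrite /kap; field; rewrite gt_eqF.
Qed.

End LowerBound.

Theorem theorem6 (R : realType) (n : nat) (c : powser R n) (b : 'I_n -> R) :
  (0 < n)%N ->
  ps_convergent c ->
  c [ffun => 0%N] = 0 ->
  non_degenerate c ->
  convenient c ->
  (forall j : 'I_n, Newton_boundary c (axis_pt j (b j))) ->
  let B := \big[Num.max/0]_(j < n) b j in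
  (Loj_exponent c <= (B - 1)%:E)%E /\
  ((exists i : 'I_n, b i = B /\ ~ Lojasiewicz_exceptional c i B) ->
     Loj_exponent c = (B - 1)%:E).
Proof.
move=> n0 ccv c0 nd _ hb B.
have /choice[mm hmm] : forall j, exists m : nat, [/\ b j = m%:R,
    c (axidx j m) != 0 & forall k, c (axidx j k) != 0 -> (m <= k)%N].
  by move=> j; exact: Newton_axis (hb j).
have bE j : b j = (mm j)%:R by have [] := hmm j.
have c_axis j : c (axidx j (mm j)) != 0 by have [] := hmm j.
have mm_min j k : (k < mm j)%N -> c (axidx j k) = 0.
  move=> kj; apply/eqP; apply: contraTT kj => ck; rewrite -leqNgt.
  by have [_ _] := hmm j; apply.
(* An exponent 0 would be the constant term, which vanishes. *)
have mm_gt0 j : (0 < mm j)%N.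
  rewrite lt0n; apply/eqP => mj0; have := c_axis j; rewrite mj0.
  rewrite (_ : axidx j 0 = [ffun => 0%N]) ?c0 ?eqxx //.
  by apply/ffunP => k; rewrite !ffunE if_same.
have b_le j : b j <= B by exact: le_bigmax.
have B1 : 1 <= B.
  by apply: le_trans (b_le (Ordinal n0)); rewrite bE ler1n.
(* [Loj_set] requires a positive exponent while [B - 1] may be 0, so [B - 1 + e] is used for every
   positive [e]. *)
have upper : (Loj_exponent c <= (B - 1)%:E)%E.
  apply/lee_addgt0Pr => e e0; rewrite -EFinD; apply: ereal_inf_lbound.
  exists (B - 1 + e) => //; apply: (Loj_set_upper c_axis mm_gt0) => //.
    by move: B1 e0; lra.
  by move=> k; rewrite -bE; move: (b_le k) e0; lra.
split=> // -[i [biB nexc]]; apply/eqP; rewrite eq_le upper /=.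
have [r [D hrD]] := ps_convergent_summable ccv.
apply: le_ereal_inf_tmp => _ [theta th <-]; rewrite lee_fin.
have <- : ((mm i).-1)%:R = B - 1 :> R by rewrite -biB bE -subn1 natrB.
apply: (@Loj_set_lower R n c i _ r D) => // j k kp.
(* For [j = i] the coefficient belongs to a power of z_i below the axis order; for [j != i] a
   nonzero one would make z_i^B exceptional. *)
have [->|ji] := eqVneq j i.
  rewrite /dcoef (_ : addidx _ _ = axidx i k.+1) ?mm_min ?mulr0 //.
    by rewrite -ltnS prednK // in kp *.
  by apply/ffunP => l; rewrite addidxE !ffunE; case: eqP; rewrite ?addn1.
apply: contrapT => /eqP; rewrite /dcoef mulf_eq0 negb_or => /andP[_ cn0].
apply: nexc; exists j, k; split => //; split.
  by rewrite -biB bE ltrBrDr natr1 ltr_nat -ltnS prednK // in kp *.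
by rewrite addidxC.
Qed.
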